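(* Let $p$ be a prime number. The categories of connective graded comodules over the graded Hopf algebroids $(MU_*,MU_*MU)$, $(BP_*,BP_*BP)$, and $((H\mathbb{F}_p)_*,(H\mathbb{F}_p)_*H\mathbb{F}_p)$ all have enough projectives. None of these categories is equivalent to the category of (ungraded) modules over a ring.
   Context: A graded Hopf algebroid $(A,\Gamma)$ is a cogroupoid object in the category of ($\mathbb{Z}$-)graded-commutative rings. A graded $\Gamma$-comodule is a graded $A$-module $M$ with a counital, coassociative, grading-preserving coaction $M\to\Gamma\otimes_A M$; it is connective if it is trivial in all negative degrees. Morphisms are the grading-preserving comodule maps. The three Hopf algebroids are those of stable co-operations in complex bordism $MU$, in $p$-local Brown-Peterson homology $BP$, and in mod $p$ classical homology (the last being the mod $p$ dual Steenrod algebra). As rings they are: $MU_*\cong\mathbb{Z}[x_1,x_2,\dots]$ and $MU_*MU\cong MU_*[b_1,b_2,\dots]$ with $|x_n|=|b_n|=2n$; $BP_*\cong\mathbb{Z}_{(p)}[v_1,v_2,\dots]$ and $BP_*BP\cong BP_*[t_1,t_2,\dots]$ with $|v_n|=|t_n|=2(p^n-1)$; $(H\mathbb{F}_p)_*\cong\mathbb{F}_p$ (in degree $0$), and $(H\mathbb{F}_p)_*H\mathbb{F}_p\cong\mathbb{F}_2[\xi_1,\xi_2,\dots]$ with $|\xi_n|=2^n-1$ if $p=2$, while $(H\mathbb{F}_p)_*H\mathbb{F}_p\cong\mathbb{F}_p[\xi_1,\xi_2,\dots]\otimes_{\mathbb{F}_p}\Lambda(\tau_0,\tau_1,\dots)$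 with $|\xi_n|=2(p^n-1)$, $|\tau_n|=2p^n-1$ if $p>2$; each carries its standard Hopf algebroid structure maps. *)

(* Defs.v *)
From HB Require Import structures.
From mathcomp Require Import all_boot all_order all_algebra.
From mathcomp Require Import boolp.

Set Implicit Arguments.
Unset Strict Implicit.
Unset Printing Implicit Defensive.

Import Order.TTheory GRing.Theory Num.Theory.
Local Open Scope ring_scope.
Local Open Scope quotient_scope.

(** * Categories *)

Record category := Category {
  ob :> Type;
  hom : ob -> ob -> Type;
  idm : forall X, hom X X;
  comp : forall X Y Z, hom Y Z -> hom X Y -> hom X Z;
  comp_idl : forall X Y (f : hom X Y), comp (idm Y) f = f;
  comp_idr : forall X Y (f : hom X Y), comp f (idm X) = f;
  compA : forall X Y Z W (h : hom Z W) (g : hom Y Z) (f : hom X Y),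
    comp h (comp g f) = comp (comp h g) f
}.
Arguments idm {c} X.
Arguments comp {c X Y Z} g f.

Section CategoryNotions.
Variable C : category.

Definition epi (X Y : C) (e : hom X Y) : Prop :=
  forall (Z : C) (g h : hom Y Z), comp g e = comp h e -> g = h.

Definition projective (P : C) : Prop :=
  forall (X Y : C) (e : hom X Y) (f : hom P Y), epi e ->
    exists g : hom P X, comp e g = f.

Definition has_enough_projectives : Prop :=
  forall X : C, exists (P : C) (e : hom P X), projective P /\ epi e.

Definition is_iso (X Y : C) (f : hom X Y) : Prop :=
  exists g : hom Y X, comp g f = idm X /\ comp f g = idm Y.
End CategoryNotions.

Record functor (C D : category) := Functor {
  fob :> C -> D;
  fmap : forall X Y : C, hom X Y -> hom (fob X) (fob Y);
  fmap_id : forall X : C, fmap (idm X) = idm (fob X);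
  fmap_comp : forall (X Y Z : C) (g : hom Y Z) (f : hom X Y),
    fmap (comp g f) = comp (fmap g) (fmap f)
}.

Definition equivalent (C D : category) : Prop :=
  exists (F : functor C D) (G : functor D C)
         (u : forall X : C, hom X (G (F X))) (v : forall Y : D, hom (F (G Y)) Y),
  [/\ forall X, is_iso (u X),
      forall Y, is_iso (v Y),
      forall (X X' : C) (f : hom X X'),
        comp (u X') f = comp (fmap G (fmap F f)) (u X)
    & forall (Y Y' : D) (g : hom Y Y'),
        comp g (v Y) = comp (v Y') (fmap F (fmap G g))].

(** * Modules over a ring *)

Section ModuleCategory.
Variable R : pzRingType.

Definition mod_hom (M N : lmodType R) : Type := {f : M -> N | linear f}.

Definition mod_id (M : lmodType R) : mod_hom M M.
Proof. by exists id => a u v. Defined.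

Definition mod_comp (M N P : lmodType R) (g : mod_hom N P) (f : mod_hom M N) :
  mod_hom M P.
Proof.
exists (sval g \o sval f) => a u v /=.
by rewrite (svalP f) (svalP g).
Defined.

Definition module_category : category.
Proof.
exists (lmodType R) mod_hom mod_id mod_comp.
- by move=> M N [f hf]; apply: eq_exist.
- by move=> M N [f hf]; apply: eq_exist.
- by move=> M N P Q h g f; apply: eq_exist.
Defined.
End ModuleCategory.

(** * Gradings *)

(* A decomposition V = \bigoplus_n V_n is given by the projections pr n of V
   onto V_n. *)
Definition is_grading (V : zmodType) (pr : int -> V -> V) : Prop :=
  [/\ forall n, {morph pr n : x y / x + y},
      forall m n x, pr m (pr n x) = if m == n then pr n x else 0
    & forall x, exists2 s : seq int, uniq s & x = \sum_(n <- s) pr n x].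

Definition homog (V : zmodType) (pr : int -> V -> V) (n : int) (x : V) : Prop :=
  pr n x = x.

Record gcring := GCRing {
  gc_ring :> pzRingType;
  gpr : int -> gc_ring -> gc_ring;
  gpr_grading : is_grading gpr;
  gpr_one : homog gpr 0 1;
  gpr_mul : forall m n x y,
    homog gpr m x -> homog gpr n y -> homog gpr (m + n) (x * y);
  gpr_comm : forall m n x y, homog gpr m x -> homog gpr n y ->
    x * y = (-1) ^+ (`|m| * `|n|)%N * (y * x)
}.

Record gcmorph (A B : gcring) := GCMorph {
  gcm_fun :> {rmorphism A -> B};
  gcm_pr : forall n x, gcm_fun (gpr n x) = gpr n (gcm_fun x)
}.

(** * Tensor products *)

(* X \otimes_A Y for a right action of A on X and a left action of A on Y: two
   formal sums of pairs are equal when every balanced map identifies them. *)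
Section Tensor.
Variables (A : Type) (X Y : zmodType) (ra : X -> A -> X) (la : A -> Y -> Y).

Definition balanced (Z : zmodType) (f : X -> Y -> Z) : Prop :=
  [/\ forall y, {morph f^~ y : x x' / x + x'},
      forall x, {morph f x : y y' / y + y'}
    & forall x a y, f (ra x a) y = f x (la a y)].

Definition feval (Z : zmodType) (f : X -> Y -> Z) (s : seq (X * Y)) : Z :=
  \sum_(xy <- s) f xy.1 xy.2.

Definition formal_eq (s t : seq (X * Y)) : Prop :=
  forall (Z : zmodType) (f : X -> Y -> Z), balanced f -> feval f s = feval f t.

Definition formal_eqb (s t : seq (X * Y)) : bool := `[< formal_eq s t >].

Lemma formal_eqb_equiv : equiv_class_of formal_eqb.
Proof.
split=> [s|s t|t s u].
- by apply/asboolP.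
- by apply: asbool_equiv_eq; split=> h Z f hf; rewrite h.
- by move=> /asboolP h1 /asboolP h2; apply/asboolP => Z f hf; rewrite h1 ?h2.
Qed.

Canonical formal_equiv := EquivRelPack formal_eqb_equiv.

Definition tens := {eq_quot formal_equiv}.
HB.instance Definition _ := Choice.on tens.
HB.instance Definition _ := EqQuotient.on tens.

(* The additive map on tens induced by a balanced map f. *)
Definition tlift (Z : zmodType) (f : X -> Y -> Z) (t : tens) : Z :=
  feval f (repr t).

Lemma tlift_pi (Z : zmodType) (f : X -> Y -> Z) (s : seq (X * Y)) :
  balanced f -> tlift f (\pi_tens s) = feval f s.
Proof.
move=> hf; rewrite /tlift.
have /eqmodP/asboolP h : repr (\pi_tens s) = s %[mod tens] by rewrite reprK.
exact: h.
Qed.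

Lemma tensP (t u : tens) :
  (forall (Z : zmodType) (f : X -> Y -> Z), balanced f ->
     tlift f t = tlift f u) -> t = u.
Proof.
move=> h; rewrite -[t]reprK -[u]reprK; apply/eqmodP/asboolP => Z f hf.
exact: h.
Qed.

Definition tens_zero : tens := \pi_tens [::].
Definition tens_add (t u : tens) : tens := \pi_tens (repr t ++ repr u).
Definition tens_opp (t : tens) : tens :=
  \pi_tens [seq (- xy.1, xy.2) | xy <- repr t].

Lemma tlift0 (Z : zmodType) (f : X -> Y -> Z) :
  balanced f -> tlift f tens_zero = 0.
Proof. by move=> hf; rewrite tlift_pi // /feval big_nil. Qed.

Lemma tliftD (Z : zmodType) (f : X -> Y -> Z) t u :
  balanced f -> tlift f (tens_add t u) = tlift f t + tlift f u.
Proof. by move=> hf; rewrite tlift_pi // /feval big_cat. Qed.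

Lemma tliftN (Z : zmodType) (f : X -> Y -> Z) t :
  balanced f -> tlift f (tens_opp t) = - tlift f t.
Proof.
move=> hf; rewrite tlift_pi // /feval big_map -sumrN.
apply: eq_bigr => -[x y] _ /=; case: hf => h1 _ _.
apply/eqP; rewrite -addr_eq0 -h1 addNr; apply/eqP.
by apply: (addrI (f 0 y)); rewrite -h1 !addr0.
Qed.

Lemma tens_addA : associative tens_add.
Proof. by move=> t u v; apply: tensP => Z f hf; rewrite !tliftD // addrA. Qed.

Lemma tens_addC : commutative tens_add.
Proof. by move=> t u; apply: tensP => Z f hf; rewrite !tliftD // addrC. Qed.

Lemma tens_add0 : left_id tens_zero tens_add.
Proof. by move=> t; apply: tensP => Z f hf; rewrite tliftD // tlift0 // add0r. Qed.

Lemma tens_addN : left_inverse tens_zero tens_opp tens_add.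
Proof.
move=> t; apply: tensP => Z f hf.
by rewrite tliftD // tliftN // tlift0 // addNr.
Qed.

HB.instance Definition _ :=
  GRing.isZmodule.Build tens tens_addA tens_addC tens_add0 tens_addN.

Definition pure (x : X) (y : Y) : tens := \pi_tens [:: (x, y)].

Lemma tlift_pure (Z : zmodType) (f : X -> Y -> Z) x y :
  balanced f -> tlift f (pure x y) = f x y.
Proof. by move=> hf; rewrite tlift_pi // /feval big_seq1. Qed.

Lemma pure_balanced : balanced pure.
Proof.
split=> [y x x'|x y y'|x a y]; apply: tensP => Z f hf.
- by rewrite [RHS](tliftD _ _ hf) !tlift_pure //; have [h _ _] := hf; exact: h.
- by rewrite [RHS](tliftD _ _ hf) !tlift_pure //; have [_ h _] := hf; exact: h.
- by rewrite !tlift_pure //; have [_ _ h] := hf; exact: h.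
Qed.

Lemma tlift_morph (Z : zmodType) (f : X -> Y -> Z) :
  balanced f -> {morph tlift f : t u / t + u}.
Proof. by move=> hf t u; rewrite -tliftD. Qed.

Lemma tens_sum (t : tens) : t = \sum_(xy <- repr t) pure xy.1 xy.2.
Proof.
apply: tensP => Z f hf; rewrite {1}/tlift /feval.
have lift0 : tlift f 0 = 0 by exact: tlift0.
rewrite (big_morph _ (tlift_morph hf) lift0).
by apply: eq_bigr => xy _; rewrite tlift_pure.
Qed.

Definition thomog (prX : int -> X -> X) (prY : int -> Y -> Y) (n : int)
    (t : tens) : Prop :=
  exists2 s : seq (X * Y), t = \sum_(xy <- s) pure xy.1 xy.2 &
    forall xy, xy \in s ->
      exists i j, [/\ i + j = n, homog prX i xy.1 & homog prY j xy.2].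
End Tensor.

Arguments tens {A X Y} ra la.
Arguments tlift {A X Y ra la Z} f t.
Arguments pure {A X Y ra la} x y.

(** * Graded Hopf algebroids *)

(* For l, r : A -> G, the ring G is an A-bimodule through l on the left and r on
   the right, and G \otimes_A Y = tens (ract r) la for every left A-module
   (Y, la). *)
Section Bimodule.
Variables (A G : pzRingType) (l r : A -> G).

Definition ract (x : G) (a : A) : G := x * r a.
Definition lact (a : A) (x : G) : G := l a * x.

Definition tlact (Y : zmodType) (la : A -> Y -> Y) (a : A)
    (t : tens ract la) : tens ract la :=
  tlift (fun x y => pure (l a * x) y) t.

(* (1 \otimes psi) psi = (Delta \otimes 1) psi in
   G \otimes_A (G \otimes_A Y). *)
Definition coassociative (Delta : G -> tens ract lact) (Y : zmodType)
    (la : A -> Y -> Y) (psi : Y -> tens ract la) : Prop :=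
  forall y : Y,
    tlift (fun x y' => pure x (psi y')) (psi y) =
    tlift (fun x y' => tlift (fun x1 x2 => pure x1 (pure x2 y')) (Delta x))
      (psi y) :> tens ract (tlact (la := la)).
End Bimodule.

(* A cogroupoid object (A, G) in graded-commutative rings.  The pushout of etaR
   and etaL is G \otimes_A G; that Delta is a morphism into it (hopf_conv) is
   tested on the morphisms G \otimes_A G -> R, that is, on the pairs f, g with
   f \o etaR = g \o etaL. *)
Record hopf_algebroid := HopfAlgebroid {
  base : gcring;
  coop : gcring;
  etaL : gcmorph base coop;
  etaR : gcmorph base coop;
  counit : gcmorph coop base;
  conj : gcmorph coop coop;
  Delta : coop -> tens (ract etaR) (lact etaL);
  hopf_counitL : forall a, counit (etaL a) = a;
  hopf_counitR : forall a, counit (etaR a) = a;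
  hopf_DeltaD : {morph Delta : x y / x + y};
  hopf_Delta1 : Delta 1 = pure 1 1;
  hopf_DeltaL : forall a x,
    Delta (etaL a * x) = tlift (fun x1 x2 => pure (etaL a * x1) x2) (Delta x);
  hopf_DeltaR : forall a x,
    Delta (x * etaR a) = tlift (fun x1 x2 => pure x1 (x2 * etaR a)) (Delta x);
  hopf_Delta_homog : forall n x,
    homog (@gpr coop) n x ->
    thomog (@gpr coop) (@gpr coop) n (Delta x);
  hopf_conv : forall (R : gcring) (f g : gcmorph coop R),
    (forall a, f (etaR a) = g (etaL a)) ->
    exists h : gcmorph coop R,
      forall x, h x = tlift (fun x1 x2 => f x1 * g x2) (Delta x);
  hopf_Delta_counitL : forall x,
    tlift (fun x1 x2 => etaL (counit x1) * x2) (Delta x) = x;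
  hopf_Delta_counitR : forall x,
    tlift (fun x1 x2 => x1 * etaR (counit x2)) (Delta x) = x;
  hopf_coassoc : coassociative Delta Delta;
  hopf_conjL : forall a, conj (etaL a) = etaR a;
  hopf_conjR : forall a, conj (etaR a) = etaL a;
  hopf_conjK : involutive conj;
  hopf_conj_mull : forall x,
    tlift (fun x1 x2 => conj x1 * x2) (Delta x) = etaR (counit x);
  hopf_conj_mulr : forall x,
    tlift (fun x1 x2 => x1 * conj x2) (Delta x) = etaL (counit x)
}.

(** * Graded comodules *)

Section Comodules.
Variable H : hopf_algebroid.
Local Notation A := (base H).
Local Notation G := (coop H).

(* G \otimes_A M *)
Definition cotens (M : lmodType A) : zmodType :=
  tens (ract (etaR H)) (fun (a : A) (v : M) => a *: v).

Record gcomodule := GComodule {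
  cm_mod :> lmodType A;
  cm_pr : int -> cm_mod -> cm_mod;
  cm_grading : is_grading cm_pr;
  cm_scale : forall m n a v,
    homog (@gpr A) m a -> homog cm_pr n v -> homog cm_pr (m + n) (a *: v);
  coact : cm_mod -> cotens cm_mod;
  coactD : {morph coact : u v / u + v};
  coactZ : forall a v,
    coact (a *: v) = tlift (fun x w => pure (etaL H a * x) w) (coact v);
  coact_homog : forall n v, homog cm_pr n v ->
    thomog (@gpr G) cm_pr n (coact v);
  coact_counit : forall v, tlift (fun x w => counit H x *: w) (coact v) = v;
  coact_coassoc : coassociative (@Delta H) coact
}.

Definition connective (M : gcomodule) : Prop :=
  forall (n : int) (v : M), n < 0 -> homog (@cm_pr M) n v -> v = 0.

Definition is_comod_hom (M N : gcomodule) (f : M -> N) : Prop :=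
  [/\ linear f,
      forall n v, f (cm_pr n v) = cm_pr n (f v)
    & forall v, coact (f v) = tlift (fun x w => pure x (f w)) (coact v)].

Lemma comod_id_subproof (M : gcomodule) : is_comod_hom (@id M).
Proof. by split=> // v; rewrite -[RHS]tens_sum. Qed.

Lemma comod_comp_subproof (M N P : gcomodule) (g : N -> P) (f : M -> N) :
  is_comod_hom g -> is_comod_hom f -> is_comod_hom (g \o f).
Proof.
move=> [lg gg cg] [lf gf cf]; split=> [a u v|n v|v] /=.
- by rewrite lf lg.
- by rewrite gf gg.
have bal (K L : gcomodule) (k : K -> L) : linear k ->
    balanced (ract (etaR H)) (fun (a : A) (w : K) => a *: w)
      (fun (x : G) (w : K) => pure x (k w) : cotens L).
  move=> lk.
  have kD u w : k (u + w) = k u + k w by rewrite -[u]scale1r lk !scale1r.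
  have k0 : k 0 = 0 by apply: (addrI (k 0)); rewrite -kD !addr0.
  have kZ a w : k (a *: w) = a *: k w by rewrite -[a *: w]addr0 lk k0 addr0.
  have [b1 b2 b3] := pure_balanced (ract (etaR H))
    (fun (a : A) (w : L) => a *: w).
  split=> [w x x'|x w w'|x a w].
  - exact: b1.
  - by rewrite kD; exact: b2.
  - by rewrite kZ; exact: b3.
rewrite cg cf; have hF := bal _ _ _ lg.
have lift0 : tlift (fun (x : G) (w : N) => pure x (g w) : cotens P)
  (0 : cotens N) = 0 by exact: (tlift0 hF).
rewrite [in X in tlift _ X = _]/tlift /feval.
rewrite (big_morph _ (tlift_morph hF) lift0).
by apply: eq_bigr => xy _; exact: (tlift_pure _ _ hF).
Qed.

Definition connective_comodule : Type := {M : gcomodule | connective M}.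

Definition conn_hom (M N : connective_comodule) : Type :=
  {f : sval M -> sval N | is_comod_hom f}.

Definition conn_id (M : connective_comodule) : conn_hom M M :=
  exist _ _ (comod_id_subproof (sval M)).

Definition conn_comp (M N P : connective_comodule) (g : conn_hom N P)
    (f : conn_hom M N) : conn_hom M P :=
  exist _ _ (comod_comp_subproof (svalP g) (svalP f)).

Definition connective_comodules : category.
Proof.
exists connective_comodule conn_hom conn_id conn_comp.
- by move=> M N [f hf]; apply: eq_exist.
- by move=> M N [f hf]; apply: eq_exist.
- by move=> M N P Q h g f; apply: eq_exist.
Defined.
End Comodules.

(** * Polynomial and exterior generators *)

Section Generators.
Variables (R S : pzRingType) (phi : R -> S).

Definition is_basis (I : eqType) (P : pred I) (e : I -> S) : Prop :=
  (forall y, exists (s : seq I) (c : I -> R),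
     [/\ uniq s, all P s & y = \sum_(i <- s) phi (c i) * e i]) /\
  (forall (s : seq I) (c : I -> R), uniq s -> all P s ->
     \sum_(i <- s) phi (c i) * e i = 0 -> forall i, i \in s -> c i = 0).

(* Monomials in generators x_1, x_2, ... are indexed by the nondecreasing
   sequences of positive integers; x 0 is never used. *)
Definition is_mono (s : seq nat) : bool := sorted leq s && (0%N \notin s).

Definition monomial (x : nat -> S) (s : seq nat) : S := \prod_(i <- s) x i.

(* S = R[x_1, x_2, ...] *)
Definition polynomial_on (x : nat -> S) : Prop :=
  is_basis is_mono (monomial x).

(* S = R[x_1, x_2, ...] \otimes \Lambda(y_0, y_1, ...); the relations among the
   generators are those of graded commutativity. *)
Definition polynomial_exterior_on (x y : nat -> S) : Prop :=
  is_basis (fun st : seq nat * seq nat => is_mono st.1 && sorted ltn st.2)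
    (fun st => monomial x st.1 * monomial y st.2).
End Generators.

(** * Complex bordism *)

(* Power series in X, Y, Z over R, by their coefficients. *)
Section PowerSeries.
Variable R : pzRingType.

Definition series := nat -> nat -> nat -> R.

Definition sone : series := fun i j k => ((i + j + k)%N == 0%N)%:R.
Definition sX : series := fun i j k => ([&& i == 1, j == 0 & k == 0]%N)%:R.
Definition sY : series := fun i j k => ([&& i == 0, j == 1 & k == 0]%N)%:R.
Definition sZ : series := fun i j k => ([&& i == 0, j == 0 & k == 1]%N)%:R.

Definition smul (f g : series) : series := fun i j k =>
  \sum_(i' < i.+1) \sum_(j' < j.+1) \sum_(k' < k.+1)
    f i' j' k' * g (i - i')%N (j - j')%N (k - k')%N.

Definition sexp (f : series) (n : nat) : series := iter n (smul f) sone.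

(* F(u, v) = \sum a_mn u^m v^n, for u and v without constant term. *)
Definition ssubst2 (a : nat -> nat -> R) (u v : series) : series :=
  fun i j k => \sum_(m < (i + j + k).+1) \sum_(n < (i + j + k).+1)
    a m n * smul (sexp u m) (sexp v n) i j k.

(* f(u) = \sum_n b_n u^(n+1), for u without constant term. *)
Definition ssubst1 (b : nat -> R) (u : series) : series :=
  fun i j k => \sum_(n < (i + j + k).+1) b n * sexp u n.+1 i j k.

Definition formal_group_law (a : nat -> nat -> R) : Prop :=
  [/\ forall i, a i 0%N = (i == 1%N)%:R,
      forall i j, a i j = a j i
    & forall i j k, ssubst2 a (ssubst2 a sX sY) sZ i j k =
                    ssubst2 a sX (ssubst2 a sY sZ) i j k].

(* f = \sum_n b_n x^(n+1), b_0 = 1, satisfies f(F(X, Y)) = F'(f(X), f(Y)). *)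
Definition strict_iso (a a' : nat -> nat -> R) (b : nat -> R) : Prop :=
  b 0%N = 1 /\
  forall i j k, ssubst1 b (ssubst2 a sX sY) i j k =
                ssubst2 a' (ssubst1 b sX) (ssubst1 b sY) i j k.
End PowerSeries.

(* (MU_*, MU_*MU): MU_* carries the universal formal group law F, and MU_*MU the
   universal strict isomorphism f : etaL F -> etaR F, f = \sum_n b_n x^(n+1).
   The coproduct is the composition of strict isomorphisms,
   Delta f = (1 \otimes f) o (f \otimes 1). *)
Definition is_MU (H : hopf_algebroid) : Prop :=
  exists (x : nat -> base H) (a : nat -> nat -> base H) (b : nat -> coop H),
  (forall n, (0 < n)%N -> homog (@gpr (base H)) (2 * n)%N%:Z (x n)) /\
  polynomial_on (fun z : int => z%:~R) x /\
  (forall i j, homog (@gpr (base H)) ((2 * (i + j))%N%:Z - 2) (a i j)) /\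
  formal_group_law a /\
  (forall (B : comPzRingType) (a' : nat -> nat -> B), formal_group_law a' ->
     exists phi : {rmorphism base H -> B},
       (forall i j, phi (a i j) = a' i j) /\
       (forall psi : {rmorphism base H -> B},
          (forall i j, psi (a i j) = a' i j) -> psi =1 phi)) /\
  (forall n, homog (@gpr (coop H)) (2 * n)%N%:Z (b n)) /\
  polynomial_on (etaL H) b /\
  strict_iso (fun i j => etaL H (a i j)) (fun i j => etaR H (a i j)) b /\
  (forall n, Delta (b n) =
     \sum_(j < n.+1)
       pure (sexp (ssubst1 b (sX (coop H))) j.+1 n.+1 0%N 0%N) (b j)).

(** * Brown-Peterson homology *)

(* The ring Z_(p), as a subring of rat. *)
Definition p_integral (p : nat) : {pred rat} :=
  fun q => coprime p `|denq q|%N.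

Lemma p_integralE (p : nat) (q : rat) :
  (q \in p_integral p) = coprime p `|denq q|%N.
Proof. by []. Qed.

Lemma p_integral_frac (p : nat) (n d : int) :
  coprime p `|d|%N -> (n%:~R / d%:~R : rat) \in p_integral p.
Proof.
rewrite p_integralE; case: divqP => [|k q k0]; first by rewrite coprimen1.
by rewrite abszM coprimeMr => /andP[].
Qed.

Lemma p_integral_subring (p : nat) : subring_closed (p_integral p).
Proof.
split=> [|q r|q r]; first by rewrite p_integralE coprimen1.
  rewrite !p_integralE => hq hr; rewrite -p_integralE.
  rewrite -[q]divq_num_den -[r]divq_num_den -mulNr.
  rewrite addf_div ?intr_eq0 ?denq_neq0 //.
  rewrite -mulrNz -!intrM -intrD; apply: p_integral_frac.
  by rewrite abszM coprimeMr hq hr.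
rewrite !p_integralE => hq hr; rewrite -p_integralE.
rewrite -[q]divq_num_den -[r]divq_num_den mulf_div -!intrM.
by apply: p_integral_frac; rewrite abszM coprimeMr hq hr.
Qed.

HB.instance Definition _ (p : nat) :=
  GRing.isSubringClosed.Build rat (p_integral p) (p_integral_subring p).

Record Zloc (p : nat) := MkZloc {
  zloc_val :> rat;
  zloc_valP : zloc_val \in p_integral p
}.

HB.instance Definition _ (p : nat) := [isSub for @zloc_val p].
HB.instance Definition _ (p : nat) := [Choice of Zloc p by <:].
HB.instance Definition _ (p : nat) :=
  [SubChoice_isSubComNzRing of Zloc p by <:].

(* (BP_*, BP_*BP) with the Hazewinkel generators v_n.  If ell_n are the
   coefficients of the logarithm, over BP_* \otimes Q, then
     p ell_n = \sum_(i < n) ell_i v_(n-i)^(p^i)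
     etaR ell_n = \sum_(i + j = n) ell_i t_j^(p^i)
     \sum_(i + j = n) ell_i Delta(t_j)^(p^i)
       = \sum_(i + j + k = n) ell_i t_j^(p^i) \otimes t_k^(p^(i+j))
   with t_0 = 1.  Below lam n = p^n ell_n lies in BP_*, which is torsion free,
   and each equation is multiplied by a power of p.  The last one lives in the
   ring G \otimes_A G and is stated through the morphisms from it, as in
   hopf_conv. *)
Definition is_BP (p : nat) (H : hopf_algebroid) : Prop :=
  exists (phi : {rmorphism Zloc p -> base H}) (v lam : nat -> base H)
         (t : nat -> coop H),
  (forall n, (0 < n)%N -> homog (@gpr (base H)) (2 * (p ^ n - 1))%N%:Z (v n)) /\
  polynomial_on phi v /\
  (forall n, homog (@gpr (coop H)) (2 * (p ^ n - 1))%N%:Z (t n)) /\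
  polynomial_on (etaL H) t /\
  lam 0%N = 1 /\
  (forall n, lam n.+1 =
     \sum_(i < n.+1) (p ^ (n - i))%:R * lam i * v (n.+1 - i)%N ^+ (p ^ i)) /\
  t 0%N = 1 /\
  (forall n, etaR H (lam n) =
     \sum_(i < n.+1) (p ^ (n - i))%:R * etaL H (lam i) * t (n - i)%N ^+ (p ^ i)) /\
  (forall (R : gcring) (f g : gcmorph (coop H) R),
     (forall a, f (etaR H a) = g (etaL H a)) ->
     forall n,
     \sum_(i < n.+1) (p ^ (n - i))%:R * f (etaL H (lam i)) *
        tlift (fun x y => f x * g y) (Delta (t (n - i)%N)) ^+ (p ^ i) =
     \sum_(i < n.+1) \sum_(j < (n - i).+1)
        (p ^ (n - i))%:R * f (etaL H (lam i)) * f (t j) ^+ (p ^ i) *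
        g (t (n - i - j)%N) ^+ (p ^ (i + j))).

(** * The dual Steenrod algebra *)

(* Milnor's presentation, with xi_0 = 1; for p = 2, |xi_n| = 2^n - 1 and there
   are no tau_n. *)
Definition is_HFp (p : nat) (H : hopf_algebroid) : Prop :=
  exists phi : {rmorphism 'F_p -> base H},
  bijective phi /\
  (forall a, homog (@gpr (base H)) 0 a) /\
  exists xi : nat -> coop H,
  xi 0%N = 1 /\
  (forall n, Delta (xi n) =
     \sum_(i < n.+1) pure (xi (n - i)%N ^+ (p ^ i)) (xi i)) /\
  if p == 2%N then
    (forall n, homog (@gpr (coop H)) (2 ^ n - 1)%N%:Z (xi n)) /\
    polynomial_on (etaL H) xi
  else
    (forall n, homog (@gpr (coop H)) (2 * (p ^ n - 1))%N%:Z (xi n)) /\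
    exists tau : nat -> coop H,
    (forall n, homog (@gpr (coop H)) (2 * p ^ n - 1)%N%:Z (tau n)) /\
    polynomial_exterior_on (etaL H) xi tau /\
    (forall n, Delta (tau n) = pure (tau n) 1 +
       \sum_(i < n.+1) pure (xi (n - i)%N ^+ (p ^ i)) (tau i)).

(* Main.v *)
(* Since Gamma is A-free with finitely many basis elements in each degree, a
   connective comodule is a graded A-module with one operation [theta i] for each
   basis element, lowering degrees; by connectivity only finitely many of them
   are nonzero on an element of bounded degree.  Hence connective comodules form
   a class of algebras closed under products, and there are free ones on graded
   sets of generators.  These are projective, because epimorphisms are onto (the
   cokernel of a morphism is again a connective comodule), and they cover
   everything.

   For the second claim, the sum of the shifts A[k], k >= 0, is also their
   product in connective comodules, since A is connective and so only finitely
   many A[k] are nonzero in a given degree.  In a module category, an infinite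
   family of nonzero modules never has equal sum and product. *)

From HB Require Import structures.
Require Import Defs.
From mathcomp Require Import all_boot all_order all_algebra.
From mathcomp Require Import boolp.

Set Implicit Arguments.
Unset Strict Implicit.
Unset Printing Implicit Defensive.

Import Order.TTheory GRing.Theory Num.Theory.
Local Open Scope ring_scope.
Local Open Scope quotient_scope.

(** * Graded groups *)

(** A product over all connective comodules would leave their universe, so the free object is made
    of formal terms, and evaluations replace the missing projections. Terms also avoid normal forms:
    the operations are additive but in general not [A]-linear, and their relations depend on the
    Hopf algebroid. Two facts must hold uniformly in the assignment. A term has a degree bound read
    off from its syntax, which makes its grading and coaction finite sums. Evaluations stay jointly
    injective after tensoring with [coop H], once and twice; for infinite families flatness does not
    give this, but coordinates for a right [A]-basis do. The given bases are left bases, and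
    conjugation turns them over. The second claim has to cross an equivalence, whose definition
    mentions no addition. The decomposition of the sum of shifts is therefore recorded by
    endomorphisms and equations between composites, a zero composite being one that does not depend
    on its argument. *)

Section AdditiveMaps.
Variables (V W : zmodType) (h : V -> W) (hD : {morph h : x y / x + y}).

Lemma madd0 : h 0 = 0.
Proof. by apply: (addrI (h 0)); rewrite -hD !addr0. Qed.

Lemma maddN x : h (- x) = - h x.
Proof. by apply/eqP; rewrite -addr_eq0 -hD addNr madd0. Qed.

Lemma maddB x y : h (x - y) = h x - h y.
Proof. by rewrite hD maddN. Qed.

Lemma madd_sum I (r : seq I) (P : pred I) F :
  h (\sum_(i <- r | P i) F i) = \sum_(i <- r | P i) h (F i).
Proof. exact: (big_morph h hD madd0). Qed.
End AdditiveMaps.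

Lemma linear_morphD (A : pzRingType) (M N : lmodType A) (h : M -> N) :
  linear h -> {morph h : x y / x + y}.
Proof. by move=> hl x y; rewrite -[x]scale1r hl !scale1r. Qed.

Lemma linear_scale (A : pzRingType) (M N : lmodType A) (h : M -> N) :
  linear h -> forall a x, h (a *: x) = a *: h x.
Proof.
by move=> hl a x; rewrite -[a *: x]addr0 hl (madd0 (linear_morphD hl)) addr0.
Qed.

Lemma big_uniq_support (V : zmodType) (I : eqType) (s t : seq I) (F : I -> V) :
  uniq s -> uniq t -> (forall i, i \notin s -> F i = 0) ->
  (forall i, i \notin t -> F i = 0) -> \sum_(i <- s) F i = \sum_(i <- t) F i.
Proof.
move=> us ut hs ht.
have aux (r r' : seq I) : uniq r -> (forall i, i \notin r' -> F i = 0) ->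
    \sum_(i <- r) F i = \sum_(i <- r | i \in r') F i.
  move=> _ h; rewrite [LHS](bigID (mem r')) /=.
  by rewrite [X in _ + X]big1 ?addr0 // => i; exact: h.
rewrite (aux s t) // (aux t s) // -[LHS]big_filter -[RHS]big_filter.
apply: perm_big; apply: uniq_perm; rewrite ?filter_uniq // => i.
by rewrite !mem_filter andbC.
Qed.

Section Gradings.
Variables (V : zmodType) (pr : int -> V -> V) (gr : is_grading pr).

Lemma gr_add n : {morph pr n : x y / x + y}.
Proof. by have [h _ _] := gr; exact: h. Qed.

Lemma gr0 n : pr n 0 = 0.
Proof. exact: (madd0 (gr_add n)). Qed.

Lemma gr_pr m n x : pr m (pr n x) = if m == n then pr n x else 0.
Proof. by have [_ h _] := gr; exact: h. Qed.

Lemma homog_pr n x : homog pr n (pr n x).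
Proof. by rewrite /homog gr_pr eqxx. Qed.

Lemma homog_proj n m x : homog pr n x -> pr m x = if m == n then x else 0.
Proof. by move=> <-; rewrite gr_pr; case: eqP => // ->. Qed.

Lemma homog0 n : homog pr n 0.
Proof. exact: gr0. Qed.

Lemma homogD n x y : homog pr n x -> homog pr n y -> homog pr n (x + y).
Proof. by rewrite /homog => hx hy; rewrite gr_add hx hy. Qed.

Lemma homog_sum n I (r : seq I) (P : pred I) F :
  (forall i, P i -> homog pr n (F i)) -> homog pr n (\sum_(i <- r | P i) F i).
Proof.
move=> h; rewrite /homog (madd_sum (gr_add n)).
by apply: eq_bigr => i Pi; exact: h.
Qed.

Lemma homog_sum_seq n (I : eqType) (r : seq I) F :
  (forall i, i \in r -> homog pr n (F i)) -> homog pr n (\sum_(i <- r) F i).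
Proof. by move=> h; rewrite big_seq; apply: homog_sum => i; exact: h. Qed.

Lemma gr_support x : exists2 s : seq int, uniq s &
  x = \sum_(n <- s) pr n x /\ forall n, n \notin s -> pr n x = 0.
Proof.
have [_ _ /(_ x) [s us e]] := gr; exists s => //; split=> // n ns.
rewrite e (madd_sum (gr_add n)) big_seq big1 // => m ms; rewrite gr_pr.
by case: eqP => // nm; rewrite nm ms in ns.
Qed.

Lemma gr_sum x (s : seq int) : uniq s ->
  (forall n, n \notin s -> pr n x = 0) -> x = \sum_(n <- s) pr n x.
Proof.
move=> us hs; have [t ut [e ht]] := gr_support x.
by rewrite {1}e; apply: big_uniq_support.
Qed.

Lemma gr_ext x y : (forall n, pr n x = pr n y) -> x = y.
Proof.
move=> e; have [s us [_ hs]] := gr_support x.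
rewrite (gr_sum us hs) (@gr_sum y s us); first by apply: eq_bigr.
by move=> n /hs; rewrite e.
Qed.
End Gradings.

(** Decomposing [x] leaves one surviving summand on each side. Homogeneity statements about
    [theta i], or about multiplication by a fixed homogeneous element, thus become commutation with
    the projections. *)
Lemma gr_shift (V W : zmodType) (pV : int -> V -> V) (pW : int -> W -> W)
    (h : V -> W) (e : int) :
  is_grading pV -> is_grading pW -> {morph h : x y / x + y} ->
  (forall n x, homog pV n x -> homog pW (n + e) (h x)) ->
  forall n x, pW (n + e) (h x) = h (pV n x).
Proof.
move=> gV gW hD hh n x; have [s us [ex _]] := gr_support gV x.
rewrite ex (madd_sum hD) !(madd_sum (gr_add gV _), madd_sum (gr_add gW _)).
rewrite (madd_sum hD); apply: eq_bigr => m _.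
rewrite (homog_proj gW _ (hh _ _ (homog_pr gV m x))) (gr_pr gV).
by rewrite (inj_eq (addIr e)); case: eqP => // _; rewrite (madd0 hD).
Qed.

Section BoundedDegree.
Variables (V : zmodType) (pr : int -> V -> V) (gr : is_grading pr).

(** One-sided because connectivity supplies the lower bound; together they leave finitely many
    degrees. *)
Definition deg_le (N : int) (x : V) := forall n, N < n -> pr n x = 0.

Lemma deg_le_exists x : exists N : nat, deg_le N%:Z x.
Proof.
have [s us [_ hs]] := gr_support gr x.
exists (\max_(n <- s) `|n|)%N => n Nn; apply: hs.
apply: contraTN Nn => ns; rewrite -leNgt.
apply: le_trans (ler_norm n) _; rewrite -abszE lez_nat.
exact: (@leq_bigmax_seq _ _ xpredT (fun n : int => `|n|%N)).
Qed.

Lemma deg_leW N N' x : N <= N' -> deg_le N x -> deg_le N' x.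
Proof. by move=> NN h n lt; apply: h; apply: le_lt_trans lt. Qed.

Lemma deg_le0 N : deg_le N 0.
Proof. by move=> n _; rewrite gr0. Qed.

Lemma deg_leD N x y : deg_le N x -> deg_le N y -> deg_le N (x + y).
Proof. by move=> hx hy n lt; rewrite gr_add // hx // hy // addr0. Qed.

Lemma deg_le_sum N I (r : seq I) (P : pred I) F :
  (forall i, P i -> deg_le N (F i)) -> deg_le N (\sum_(i <- r | P i) F i).
Proof. by move=> h; elim/big_ind: _ => //; [exact: deg_le0|exact: deg_leD]. Qed.

Lemma homog_deg_le n x : homog pr n x -> deg_le n x.
Proof.
by move=> hx m lt; rewrite (homog_proj gr _ hx) gt_eqF.
Qed.
End BoundedDegree.

(** * Tensor products *)

Section TensorLifts.
Variables (A : Type) (X Y : zmodType) (ra : X -> A -> X) (la : A -> Y -> Y).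
Implicit Types t u : tens ra la.

(** [tlift] sums over the chosen representative of [t], so it can be compared, composed and split
    summand by summand for arbitrary functions; balancedness matters once the argument is written as
    a pure tensor or a sum. *)
Lemma eq_tlift (Z : zmodType) (f g : X -> Y -> Z) t :
  (forall x y, f x y = g x y) -> tlift f t = tlift g t.
Proof. by move=> e; apply: eq_bigr => xy _. Qed.

Lemma tlift_comp (Z Z' : zmodType) (g : Z -> Z') (f : X -> Y -> Z) t :
  {morph g : x y / x + y} ->
  g (tlift f t) = tlift (fun x y => g (f x y)) t.
Proof. by move=> gD; rewrite /tlift /feval (madd_sum gD). Qed.

Lemma tlift_add2 (Z : zmodType) (f g : X -> Y -> Z) t :
  tlift (fun x y => f x y + g x y) t = tlift f t + tlift g t.
Proof. by rewrite /tlift /feval big_split. Qed.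

Lemma tlift_id t : tlift pure t = t.
Proof. by rewrite [RHS]tens_sum. Qed.

Lemma tens_ext (Z : zmodType) (F F' : tens ra la -> Z) :
  {morph F : t u / t + u} -> {morph F' : t u / t + u} ->
  (forall x y, F (pure x y) = F' (pure x y)) -> forall t, F t = F' t.
Proof.
move=> FD FD' e t; rewrite -[t]tlift_id !tlift_comp //.
exact: eq_tlift.
Qed.

Lemma pureDl x x' y : pure (x + x') y = pure x y + pure x' y :> tens ra la.
Proof. by have [h _ _] := pure_balanced ra la; exact: h. Qed.

Lemma pureDr x y y' : pure x (y + y') = pure x y + pure x y' :> tens ra la.
Proof. by have [_ h _] := pure_balanced ra la; exact: h. Qed.

Lemma pureA x a y : pure (ra x a) y = pure x (la a y) :> tens ra la.
Proof. by have [_ _ h] := pure_balanced ra la; exact: h. Qed.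

Lemma pure0l y : pure 0 y = 0 :> tens ra la.
Proof. by apply: (madd0 (h := pure^~ y)) => x x'; rewrite pureDl. Qed.

Lemma pure0r x : pure x 0 = 0 :> tens ra la.
Proof. by apply: (madd0 (h := pure x)) => y y'; rewrite pureDr. Qed.
End TensorLifts.

Section TensorMap.
Variables (A : Type) (X Y Y' : zmodType) (ra : X -> A -> X).
Variables (la : A -> Y -> Y) (la' : A -> Y' -> Y').

Definition tmap (h : Y -> Y') (t : tens ra la) : tens ra la' :=
  tlift (fun x y => pure x (h y)) t.

Variable h : Y -> Y'.
Hypotheses (hD : {morph h : x y / x + y})
  (hla : forall a y, h (la a y) = la' a (h y)).

Lemma tmap_balanced :
  balanced ra la (fun x y => pure x (h y) : tens ra la').
Proof.
split=> [y x x'|x y y'|x a y]; first exact: pureDl.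
  by rewrite hD pureDr.
by rewrite hla pureA.
Qed.

Lemma tmapD : {morph tmap h : t u / t + u}.
Proof. exact: (tlift_morph tmap_balanced). Qed.

Lemma tmap_pure x y : tmap h (pure x y) = pure x (h y).
Proof. exact: (tlift_pure _ _ tmap_balanced). Qed.

Lemma tlift_tmap (Z : zmodType) (f : X -> Y' -> Z) t : balanced ra la' f ->
  tlift f (tmap h t) = tlift (fun x y => f x (h y)) t.
Proof.
move=> hf; rewrite (tlift_comp _ _ (tlift_morph hf)).
by apply: eq_tlift => x y; rewrite tlift_pure.
Qed.

Lemma thomog_tmap (pX : int -> X -> X) (pY : int -> Y -> Y)
    (pY' : int -> Y' -> Y') n t :
  (forall m y, homog pY m y -> homog pY' m (h y)) ->
  thomog pX pY n t -> thomog pX pY' n (tmap h t).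
Proof.
move=> hh [s -> hs]; exists [seq (xy.1, h xy.2) | xy <- s].
  rewrite big_map (madd_sum tmapD).
  by apply: eq_bigr => xy _; rewrite tmap_pure.
move=> _ /mapP[xy /hs[i [j [ij hi hj]]] ->]; exists i, j.
by split=> //; exact: hh.
Qed.
End TensorMap.

(** Unbundled, to cover both the scaling of a module and [tlact] on a tensor product, which carries
    no module instance. *)
Definition laction (A : pzRingType) (Y : zmodType) (la : A -> Y -> Y) : Prop :=
  [/\ forall a, {morph la a : y y' / y + y'},
      forall y, {morph la^~ y : a b / a + b}
    & forall a b y, la a (la b y) = la (a * b) y].

Lemma laction_scale (A : pzRingType) (M : lmodType A) :
  laction (fun (a : A) (v : M) => a *: v).
Proof.
split=> [a v w|v a b|a b v]; first exact: scalerDr.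
  exact: scalerDl.
exact: scalerA.
Qed.

Section HopfTensors.
Variable H : hopf_algebroid.
Local Notation A := (base H).
Local Notation G := (coop H).
Local Notation rG := (ract (etaR H)).
Local Notation act2 la := (@tlact A G (etaL H) (etaR H) _ la).

Section LeftAction.
Variables (Y : zmodType) (la : A -> Y -> Y).

Lemma tlact_balanced a :
  balanced rG la (fun x y => pure (etaL H a * x) y : tens rG la).
Proof.
split=> [y x x'|x y y'|x b y]; rewrite ?mulrDr ?pureDl ?pureDr //.
by rewrite -pureA /ract mulrA.
Qed.

Lemma tlact_pure a x y :
  tlact (etaL H) a (pure x y : tens rG la) = pure (etaL H a * x) y.
Proof. exact: (tlift_pure _ _ (tlact_balanced a)). Qed.

Lemma laction_tlact : laction (act2 la).
Proof.
split=> [a|t a b|a b t]; first exact: (tlift_morph (tlact_balanced a)).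
  rewrite /tlact -tlift_add2; apply: eq_tlift => x y.
  by rewrite rmorphD mulrDl pureDl.
rewrite {2}/tlact tlift_comp; last exact: (tlift_morph (tlact_balanced a)).
apply: eq_tlift => x y; rewrite -/(tlact _ _ _) tlact_pure.
by rewrite rmorphM mulrA.
Qed.
End LeftAction.

Lemma tlact_tmap (Y Y' : zmodType) (la : A -> Y -> Y) (la' : A -> Y' -> Y')
    (h : Y -> Y') :
  {morph h : x y / x + y} -> (forall a y, h (la a y) = la' a (h y)) ->
  forall a (t : tens rG la),
  tmap la' h (tlact (etaL H) a t) = tlact (etaL H) a (tmap la' h t).
Proof.
move=> hD hla a; apply: tens_ext => [t u|t u|x y].
- by have [h1 _ _] := laction_tlact la; rewrite h1 tmapD.
- rewrite tmapD //; have [h1 _ _] := laction_tlact la'; exact: h1.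
by rewrite tlact_pure !tmap_pure // tlact_pure.
Qed.

Lemma comult_balanced (Y : zmodType) (la : A -> Y -> Y) (y : Y) :
  balanced rG (lact (etaL H))
    (fun x1 x2 => pure x1 (pure x2 y) : tens rG (act2 la)).
Proof.
split=> [x2 x x'|x x2 x2'|x a x2]; rewrite ?pureDl ?pureDr //.
by rewrite pureA tlact_pure.
Qed.

Lemma coassoc_balanced (Y : zmodType) (la : A -> Y -> Y) :
  balanced rG la (fun x y =>
    tlift (fun x1 x2 => pure x1 (pure x2 y)) (Delta x)
      : tens rG (act2 la)).
Proof.
split=> [y x x'|x y y'|x a y].
- by rewrite hopf_DeltaD (tlift_morph (comult_balanced la y)).
- by rewrite -tlift_add2; apply: eq_tlift => x1 x2; rewrite !pureDr.
rewrite /ract hopf_DeltaR tlift_comp; last first.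
  exact: (tlift_morph (comult_balanced la y)).
apply: eq_tlift => x1 x2; rewrite (tlift_pure _ _ (comult_balanced la y)).
by rewrite -pureA.
Qed.

(** With [tmap_coassocL], which treats the other side of coassociativity, this naturality carries
    the axiom forward along a surjection ([image_comodule]) and back along the jointly injective
    evaluations ([free_comodule]). *)
Lemma tmap_coassocR (Y Y' : zmodType) (la : A -> Y -> Y) (la' : A -> Y' -> Y')
    (h : Y -> Y') (t : tens rG la) :
  {morph h : x y / x + y} -> (forall a y, h (la a y) = la' a (h y)) ->
  tmap (act2 la') (tmap la' h)
    (tlift (fun x y' => tlift (fun x1 x2 => pure x1 (pure x2 y')) (Delta x)) t
      : tens rG (act2 la)) =
  tlift (fun x y' => tlift (fun x1 x2 => pure x1 (pure x2 y')) (Delta x))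
    (tmap la' h t).
Proof.
move=> hD hla; have tD := tmapD (ra := rG) hD hla.
have tt := tlact_tmap hD hla.
rewrite tlift_tmap //; last exact: coassoc_balanced.
rewrite tlift_comp; last exact: tmapD.
apply: eq_tlift => x y; rewrite tlift_comp; last exact: tmapD.
by apply: eq_tlift => x1 x2; rewrite !tmap_pure.
Qed.

Lemma tmap_coassocL (Y Y' : zmodType) (la : A -> Y -> Y) (la' : A -> Y' -> Y')
    (h : Y -> Y') (psi : Y -> tens rG la) (psi' : Y' -> tens rG la')
    (t : tens rG la) :
  {morph h : x y / x + y} -> (forall a y, h (la a y) = la' a (h y)) ->
  {morph psi' : x y / x + y} ->
  (forall a y, psi' (la' a y) = tlact (etaL H) a (psi' y)) ->
  (forall y, psi' (h y) = tmap la' h (psi y)) ->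
  tmap (act2 la') (tmap la' h)
    (tlift (fun x y => pure x (psi y)) t : tens rG (act2 la)) =
  tlift (fun x y => pure x (psi' y)) (tmap la' h t).
Proof.
move=> hD hla pD pZ hpsi; have tD := tmapD (ra := rG) hD hla.
have tt := tlact_tmap hD hla.
rewrite tlift_tmap //; last exact: tmap_balanced.
rewrite tlift_comp; last exact: tmapD.
by apply: eq_tlift => x y; rewrite !tmap_pure // hpsi.
Qed.
End HopfTensors.

(** * Coordinates on the cooperations *)

(* [rc_f] is a homogeneous basis of the cooperations as a right module through
   [etaR], padded with zeros, and [rc_c i x] is the coefficient of [rc_f i] in
   [x]; [rc_fin] says that the basis is finite in bounded degrees. *)
Record right_coordinates (H : hopf_algebroid) := RightCoordinates {
  rc_index : eqType;
  rc_f : rc_index -> coop H;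
  rc_c : rc_index -> coop H -> base H;
  rc_deg : rc_index -> int;
  rc_add : forall i, {morph rc_c i : x y / x + y};
  rc_ract : forall i x a, rc_c i (x * etaR H a) = rc_c i x * a;
  rc_expand : forall x, exists2 s : seq rc_index, uniq s &
    (forall i, i \notin s -> rc_c i x = 0) /\
    x = \sum_(i <- s) rc_f i * etaR H (rc_c i x);
  rc_f_homog : forall i, homog (@gpr (coop H)) (rc_deg i) (rc_f i);
  rc_c_homog : forall i m x, homog (@gpr (coop H)) m x ->
    homog (@gpr (base H)) (m - rc_deg i) (rc_c i x);
  rc_fin : forall N : int, exists2 s : seq rc_index, uniq s &
    forall i, i \notin s -> N < rc_deg i \/ forall x, rc_c i x = 0
}.

Section TensorCoordinates.
Variables (H : hopf_algebroid) (K : right_coordinates H).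
Local Notation A := (base H).
Local Notation G := (coop H).
Local Notation rG := (ract (etaR H)).

Section OneFactor.
Implicit Type i : rc_index K.
Variables (Y : zmodType) (la : A -> Y -> Y) (laP : laction la).

Lemma laction0l y : la 0 y = 0.
Proof. by have [_ h _] := laP; exact: madd0 (h y). Qed.

Lemma pure_mulr x a y : pure (x * etaR H a) y = pure x (la a y) :> tens rG la.
Proof. exact: (pureA rG la x a y). Qed.

(** For a right basis these are the components of the isomorphism between the tensor product and a
    direct sum of copies of [Y]. *)
Definition tcoord (i : rc_index K) (t : tens rG la) : Y :=
  tlift (fun x y => la (rc_c i x) y) t.

Lemma tcoord_balanced i : balanced rG la (fun x y => la (rc_c i x) y).
Proof.
have [h1 h2 h3] := laP; split=> [y x x'|x y y'|x a y].
- by rewrite rc_add h2.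
- exact: h1.
by rewrite /ract rc_ract h3.
Qed.

Lemma tcoordD i : {morph tcoord i : t u / t + u}.
Proof. exact: (tlift_morph (tcoord_balanced i)). Qed.

Lemma tcoord_pure i x y : tcoord i (pure x y) = la (rc_c i x) y.
Proof. exact: (tlift_pure _ _ (tcoord_balanced i)). Qed.

(** Expanding [x] in a pure tensor by [rc_expand] and moving the scalars across turns it into the
    sum of the [pure (rc_f i) (la (rc_c i x) y)]; the induction merges the finite supports. *)
Lemma tcoord_expand t : exists2 s : seq (rc_index K), uniq s &
  (forall i, i \notin s -> tcoord i t = 0) /\
  t = \sum_(i <- s) pure (rc_f i) (tcoord i t).
Proof.
rewrite -[t]tlift_id /tlift /feval.
elim/big_rec: _ => [|[x y] u _ [s us [s0 es]]].
  by exists [::] => //; rewrite big_nil; split=> // i _; rewrite (madd0 (tcoordD i)).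
have [r ur [r0 er]] := rc_expand K x.
exists (undup (s ++ r)); rewrite ?undup_uniq //.
have out i : i \notin undup (s ++ r) -> i \notin s /\ i \notin r.
  by rewrite mem_undup mem_cat negb_or => /andP.
split=> [i /out[hs hr]|].
  by rewrite tcoordD tcoord_pure r0 // laction0l s0 // addr0.
under eq_bigr => i _ do rewrite tcoordD pureDr.
rewrite big_split /=; congr (_ + _); last first.
  rewrite {1}es; apply: big_uniq_support; rewrite ?undup_uniq // => i.
    by move=> /s0 ->; rewrite pure0r.
  by move=> /out[/s0 -> _]; rewrite pure0r.
rewrite {1}er (madd_sum (h := fun x => pure x y)); last first.
  by move=> x1 x2; rewrite pureDl.
transitivity (\sum_(i <- r) (pure (rc_f i) (tcoord i (pure x y)) : tens rG la)).
  by apply: eq_bigr => i _; rewrite tcoord_pure; exact: pure_mulr.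
apply: big_uniq_support; rewrite ?undup_uniq // => i.
  by move=> /r0; rewrite tcoord_pure => ->; rewrite laction0l pure0r.
by move=> /out[_ /r0]; rewrite tcoord_pure => ->; rewrite laction0l pure0r.
Qed.

(** Since coordinates are natural in [Y] ([tcoord_tmap]), this transfers joint injectivity from a
    family of maps out of [Y] to the induced maps of tensor products. *)
Lemma tcoord_inj t u : (forall i, tcoord i t = tcoord i u) -> t = u.
Proof.
move=> e; apply/eqP; rewrite -subr_eq0; apply/eqP.
have [s us [_ ->]] := tcoord_expand (t - u).
by rewrite big1 // => i _; rewrite (maddB (tcoordD i)) e subrr pure0r.
Qed.
End OneFactor.

Lemma tcoord_tmap (Y Y' : zmodType) (la : A -> Y -> Y) (la' : A -> Y' -> Y')
    (h : Y -> Y') : laction la -> laction la' ->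
  {morph h : x y / x + y} -> (forall a y, h (la a y) = la' a (h y)) ->
  forall i t, tcoord i (tmap la' h t) = h (tcoord (la := la) i t).
Proof.
move=> laP laP' hD hla i; apply: tens_ext => [t u|t u|x y].
- by rewrite tmapD // tcoordD.
- by rewrite tcoordD.
by rewrite tmap_pure // !tcoord_pure.
Qed.
End TensorCoordinates.

(** * The coaction as a family of degree-lowering operations *)

Section ComoduleOperations.
Variables (H : hopf_algebroid) (K : right_coordinates H).
Local Notation A := (base H).
Local Notation G := (coop H).

(** The coaction of [v] is the finite sum of the [pure (rc_f i) (theta i v)]. Scaling [v] acts
    through [etaL], while the coefficients are taken for [etaR]; hence only additivity is
    claimed. *)
Definition theta (M : gcomodule H) (i : rc_index K) (v : M) : M :=
  tcoord i (coact v).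

Lemma thetaD (M : gcomodule H) i : {morph @theta M i : v w / v + w}.
Proof. by move=> v w; rewrite /theta coactD tcoordD //; exact: laction_scale. Qed.

Lemma theta_homog (M : gcomodule H) i n (v : M) :
  homog (@cm_pr _ M) n v -> homog (@cm_pr _ M) (n - rc_deg i) (theta i v).
Proof.
move=> /coact_homog[s e hs]; rewrite /theta e.
rewrite (madd_sum (tcoordD (laction_scale M) i)).
apply: homog_sum_seq => [|[x w] /hs[a [b [<- ha hb]]] /=].
  exact: cm_grading.
rewrite tcoord_pure; last exact: laction_scale.
by rewrite addrAC; apply: cm_scale => //; exact: rc_c_homog.
Qed.

Lemma comod_homD (M N : gcomodule H) (h : M -> N) :
  is_comod_hom h -> {morph h : v w / v + w}.
Proof. by case=> /linear_morphD. Qed.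

Lemma comod_homZ (M N : gcomodule H) (h : M -> N) :
  is_comod_hom h -> forall a v, h (a *: v) = a *: h v.
Proof. by case=> /linear_scale. Qed.

Lemma comod_hom_theta (M N : gcomodule H) (h : M -> N) : is_comod_hom h ->
  forall i v, h (theta i v) = theta i (h v).
Proof.
move=> hh i v; case: (hh) => _ _ e; rewrite /theta e.
symmetry; apply: tcoord_tmap; [exact: laction_scale..| |].
  exact: comod_homD.
exact: comod_homZ.
Qed.

Lemma conn_neg (M : gcomodule H) : connective M ->
  forall n (v : M), n < 0 -> cm_pr n v = 0.
Proof.
by move=> hM n v n0; apply: (hM n) => //; apply: homog_pr; exact: cm_grading.
Qed.

Lemma theta_pr (M : gcomodule H) i n (v : M) :
  cm_pr n (theta i v) = theta i (cm_pr (n + rc_deg i) v).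
Proof.
have := gr_shift (@cm_grading _ M) (@cm_grading _ M) (@thetaD M i)
  (@theta_homog M i) (n + rc_deg i) v.
by rewrite addrK.
Qed.

(** The result would live in degrees at most [N - rc_deg i], which is negative. *)
Lemma theta_bound (M : gcomodule H) : connective M -> forall N i (v : M),
  deg_le (@cm_pr _ M) N v -> N < rc_deg i -> theta i v = 0.
Proof.
move=> hM N i v vN Ni; apply: (gr_ext (@cm_grading _ M)) => n.
rewrite (gr0 (@cm_grading _ M)).
have [n0|n0] := ltP n 0; first exact: conn_neg.
rewrite theta_pr vN ?(madd0 (@thetaD M i)) //.
by apply: (lt_le_trans Ni); rewrite lerDr.
Qed.
End ComoduleOperations.

Section GradedScaling.
Variables (A : gcring) (M : lmodType A) (pr : int -> M -> M).
Hypotheses (gr : is_grading pr)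
  (sc : forall m n a v, homog (@gpr A) m a -> homog pr n v ->
          homog pr (m + n) (a *: v)).

Lemma deg_le_scale N N' (a : A) (v : M) :
  deg_le (@gpr A) N a -> deg_le pr N' v -> deg_le pr (N + N') (a *: v).
Proof.
move=> ha hv; have [s us [-> _]] := gr_support (@gpr_grading A) a.
have [t ut [-> _]] := gr_support gr v.
rewrite scaler_suml; apply: deg_le_sum => // m _.
rewrite scaler_sumr; apply: deg_le_sum => // n _.
have [Nm|mN] := ltP N m; first by rewrite ha // scale0r; exact: deg_le0.
have [Nn|nN] := ltP N' n; first by rewrite hv // scaler0; exact: deg_le0.
apply: (deg_leW (lerD mN nN)); apply: homog_deg_le => //.
by apply: sc; apply: homog_pr => //; exact: gpr_grading.
Qed.
End GradedScaling.

Lemma gcm_homog (B C : gcring) (h : gcmorph B C) n x :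
  homog (@gpr B) n x -> homog (@gpr C) n (h x).
Proof. by rewrite /homog -gcm_pr => ->. Qed.

(** Even degrees make the image of [A] central in every graded-commutative ring; nonnegative ones
    make the family of shifts of [A] locally finite. *)
Definition even_connective (A : gcring) : Prop :=
  forall a : A, exists2 s : seq (nat * A), a = \sum_(x <- s) x.2 &
    forall x, x \in s -> homog (@gpr A) (2 * x.1)%N%:Z x.2.

Lemma even_connective_neg (A : gcring) : even_connective A ->
  forall n (a : A), n < 0 -> gpr n a = 0.
Proof.
move=> hA n a n0; have [s -> hs] := hA a.
rewrite (madd_sum (gr_add (@gpr_grading A) n)) big_seq big1 // => x /hs hx.
rewrite (homog_proj (@gpr_grading A) _ hx); case: eqP => // e.
by rewrite e in n0.
Qed.

Lemma even_gcomm (A G : gcring) (h : gcmorph A G) : even_connective A ->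
  forall a x, h a * x = x * h a.
Proof.
move=> hA a x; have [s -> hs] := hA a.
rewrite rmorph_sum mulr_suml mulr_sumr big_seq [RHS]big_seq.
apply: eq_bigr => b /hs hb.
have [t _ [-> _]] := gr_support (@gpr_grading G) x.
rewrite mulr_suml mulr_sumr; apply: eq_bigr => n _.
rewrite (gpr_comm (gcm_homog h hb) (homog_pr (@gpr_grading G) n x)).
by rewrite absz_nat -signr_odd -mulnA oddM mul1r.
Qed.

(** * From a left basis to right coordinates *)

Section LeftBasis.
Variables (H : hopf_algebroid) (evenA : even_connective (base H)).
Variables (I : eqType) (P : pred I) (e : I -> coop H) (w : I -> nat).
Hypotheses (eB : is_basis (etaL H) P e)
  (e_homog : forall i, P i -> homog (@gpr (coop H)) (w i)%:Z (e i))
  (e_fin : forall N : nat, exists L : seq I,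
     forall i, P i -> (w i <= N)%N -> i \in L).
Local Notation A := (base H).
Local Notation G := (coop H).

(** Coefficients are extended by zero to all of [I], so that their uniqueness is an equality of
    functions. *)
Definition left_coords (x : G) (a : I -> A) : Prop :=
  exists s : seq I, [/\ uniq s, all P s, forall i, i \notin s -> a i = 0 &
    x = \sum_(i <- s) etaL H (a i) * e i].

Lemma left_coords_exists x : exists a, left_coords x a.
Proof.
have [/(_ x)[s [c [us Ps ->]]] _] := eB.
exists (fun i => if i \in s then c i else 0), s; split=> //.
  by move=> i /negbTE ->.
by rewrite big_seq [RHS]big_seq; apply: eq_bigr => i ->.
Qed.

Lemma left_coords_widen x a s (t : seq I) : uniq s -> uniq t ->
  {subset s <= t} -> (forall i, i \notin s -> a i = 0) ->
  x = \sum_(i <- s) etaL H (a i) * e i -> x = \sum_(i <- t) etaL H (a i) * e i.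
Proof.
move=> us ut st a0 ->.
apply: big_uniq_support => // i hi; rewrite a0 ?rmorph0 ?mul0r //.
by apply: contra hi => /st.
Qed.

Lemma left_coords_common x y a b : left_coords x a -> left_coords y b ->
  exists t : seq I, [/\ uniq t, all P t,
    forall i, i \notin t -> a i = 0 /\ b i = 0,
    x = \sum_(i <- t) etaL H (a i) * e i &
    y = \sum_(i <- t) etaL H (b i) * e i].
Proof.
move=> [s [us Ps a0 ex]] [r [ur Pr b0 ey]].
exists (undup (s ++ r)); split; rewrite ?undup_uniq //.
- by apply/allP => i; rewrite mem_undup mem_cat => /orP[/(allP Ps)|/(allP Pr)].
- by move=> i; rewrite mem_undup mem_cat negb_or => /andP[/a0 -> /b0 ->].
- apply: left_coords_widen ex => //; rewrite ?undup_uniq // => i.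
  by rewrite mem_undup mem_cat => ->.
apply: left_coords_widen ey => //; rewrite ?undup_uniq // => i.
by rewrite mem_undup mem_cat orbC => ->.
Qed.

Lemma left_coords_uniq x a b : left_coords x a -> left_coords x b -> a = b.
Proof.
move=> ha hb; have [t [ut Pt t0 ea eb]] := left_coords_common ha hb.
apply/funext => i; have [it|/t0[-> ->] //] := boolP (i \in t).
apply/eqP; rewrite -subr_eq0; apply/eqP.
have [_ free] := eB; apply: (free t (fun i => a i - b i)) => //.
under eq_bigr => j _ do rewrite rmorphB mulrBl.
by rewrite sumrB -ea -eb subrr.
Qed.

Lemma left_coordsD x y a b : left_coords x a -> left_coords y b ->
  left_coords (x + y) (fun i => a i + b i).
Proof.
move=> ha hb; have [t [ut Pt t0 -> ->]] := left_coords_common ha hb.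
exists t; split=> // [i /t0[-> ->]|]; first by rewrite addr0.
by rewrite -big_split; apply: eq_bigr => i _; rewrite rmorphD mulrDl.
Qed.

Lemma left_coordsZ x a b :
  left_coords x a -> left_coords (etaL H b * x) (fun i => b * a i).
Proof.
move=> [s [us Ps a0 ->]]; exists s; split=> // [i /a0 ->|]; first by rewrite mulr0.
by rewrite mulr_sumr; apply: eq_bigr => i _; rewrite rmorphM mulrA.
Qed.

(** Projecting the expansion of [x] to degree [m] gives another expansion of [x], whose coefficients
    are the projections of the [a i] to degree [m - w i]; uniqueness identifies the two. *)
Lemma left_coords_homog x a m : left_coords x a -> homog (@gpr G) m x ->
  forall i, homog (@gpr A) (m - (w i)%:Z) (a i).
Proof.
move=> ha hx i; rewrite /homog; move: (ha) => [s [us Ps a0 ex]].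
suff /(left_coords_uniq ha) {2}-> :
  left_coords x (fun i => gpr (m - (w i)%:Z) (a i)) by [].
exists s; split=> // [j /a0 ->|]; first exact: gr0 (@gpr_grading A) _.
rewrite -hx {1}ex (madd_sum (gr_add (@gpr_grading G) m)).
rewrite big_seq [RHS]big_seq; apply: eq_bigr => j /(allP Ps) Pj.
rewrite -{1}[m](subrK (w j)%:Z).
apply: (gr_shift (h := fun a => etaL H a * e j) (@gpr_grading A) (@gpr_grading G)).
  by move=> b c; rewrite rmorphD mulrDl.
by move=> n b hb; apply: gpr_mul; [exact: gcm_homog|exact: e_homog].
Qed.

(** Centrality is known for images under graded morphisms; [etaL] provides one, and [counit]
    retracts it. *)
Lemma even_mulC (a b : A) : a * b = b * a.
Proof.
rewrite -[LHS]hopf_counitL rmorphM (even_gcomm _ evenA) -rmorphM.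
exact: hopf_counitL.
Qed.

(** [conj] is an involution exchanging [etaL] and [etaR]: the conjugated basis elements serve on the
    right, and the right coefficients of [x] are the left coefficients of [conj x]. *)
Lemma right_coordinates_of_left_basis : inhabited (right_coordinates H).
Proof.
have [co coP] := choice left_coords_exists.
pose c i (x : G) := co (conj H x) i.
(* Indices outside [P] are padded by 0; their coefficients vanish too, which is the second
   alternative in [rc_fin]. *)
pose f i := if P i then conj H (e i) else 0.
apply: inhabits; apply: (@RightCoordinates H I f c (fun i => (w i)%:Z)).
- move=> i x y; rewrite /c rmorphD.
  by rewrite (left_coords_uniq (coP _) (left_coordsD (coP _) (coP _))).
- move=> i x a; rewrite /c rmorphM hopf_conjR -(even_gcomm _ evenA).
  rewrite (left_coords_uniq (coP _) (left_coordsZ a (coP _))).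
  exact: even_mulC.
- move=> x; have [s [us Ps c0 ex]] := coP (conj H x); exists s => //; split=> //.
  rewrite -[LHS]hopf_conjK {1}ex rmorph_sum big_seq [RHS]big_seq.
  apply: eq_bigr => i /(allP Ps) Pi; rewrite rmorphM hopf_conjL /f Pi.
  by rewrite (even_gcomm _ evenA).
- move=> i; rewrite /f; case: ifP => [Pi|_].
    by apply: gcm_homog; exact: e_homog.
  exact: homog0 (@gpr_grading G) _.
- by move=> i m x hx; apply: (left_coords_homog (coP _)); exact: gcm_homog.
move=> N; have [L hL] := e_fin `|N|%N; exists (undup L); rewrite ?undup_uniq // => i.
rewrite mem_undup => iL; have [Pi|nPi] := boolP (P i); [left|right].
  apply: le_lt_trans (ler_norm N) _; rewrite -abszE ltz_nat ltnNge.
  by apply: contra iL; exact: hL.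
move=> x; have [s [_ Ps c0 _]] := coP (conj H x); apply: c0.
by apply: contra nPi => /(allP Ps).
Qed.
End LeftBasis.

(** * Quotient modules *)

(** Serves three quotients: by a submodule, of terms by equal evaluations, and of sequences by
    trailing zeros. Negation is scaling by [-1]. *)
Record premodule (A : pzRingType) (T : choiceType) := Premodule {
  pm_eq : T -> T -> Prop;
  pm_zero : T;
  pm_add : T -> T -> T;
  pm_scale : A -> T -> T;
  pm_refl : forall t, pm_eq t t;
  pm_sym : forall t u, pm_eq t u -> pm_eq u t;
  pm_trans : forall t u v, pm_eq t u -> pm_eq u v -> pm_eq t v;
  pm_add_congr : forall t t' u u',
    pm_eq t t' -> pm_eq u u' -> pm_eq (pm_add t u) (pm_add t' u');
  pm_scale_congr : forall a t t',
    pm_eq t t' -> pm_eq (pm_scale a t) (pm_scale a t');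
  pm_addA : forall t u v, pm_eq (pm_add t (pm_add u v)) (pm_add (pm_add t u) v);
  pm_addC : forall t u, pm_eq (pm_add t u) (pm_add u t);
  pm_add0 : forall t, pm_eq (pm_add pm_zero t) t;
  pm_addN : forall t, pm_eq (pm_add (pm_scale (-1) t) t) pm_zero;
  pm_scaleA : forall a b t,
    pm_eq (pm_scale a (pm_scale b t)) (pm_scale (a * b) t);
  pm_scale1 : forall t, pm_eq (pm_scale 1 t) t;
  pm_scaleDr : forall a t u,
    pm_eq (pm_scale a (pm_add t u)) (pm_add (pm_scale a t) (pm_scale a u));
  pm_scaleDl : forall a b t,
    pm_eq (pm_scale (a + b) t) (pm_add (pm_scale a t) (pm_scale b t))
}.

Section ModuleQuotient.
Variables (A : pzRingType) (T : choiceType) (S : premodule A T).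

Definition pm_eqb (t u : T) : bool := `[< pm_eq S t u >].

Lemma pm_eqb_equiv : equiv_class_of pm_eqb.
Proof.
split=> [t|t u|t u v].
- by apply/asboolP; exact: pm_refl.
- by apply: asbool_equiv_eq; split; exact: pm_sym.
by move=> /asboolP h1 /asboolP h2; apply/asboolP; exact: pm_trans h1 h2.
Qed.

Canonical pm_equiv := EquivRelPack pm_eqb_equiv.

Definition mquot := {eq_quot pm_equiv}.
HB.instance Definition _ := Choice.on mquot.
HB.instance Definition _ := EqQuotient.on mquot.

Definition mclass (t : T) : mquot := \pi_mquot t.

Lemma mclass_eq t u : mclass t = mclass u <-> pm_eq S t u.
Proof. by split=> [/eqmodP/asboolP|h] //; apply/eqmodP/asboolP. Qed.

Lemma mrepr_eq t : pm_eq S (repr (mclass t)) t.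
Proof. by apply/mclass_eq; rewrite /mclass reprK. Qed.

Lemma mclass_repr q : mclass (repr q) = q.
Proof. exact: reprK. Qed.

Definition mq_add (q r : mquot) := mclass (pm_add S (repr q) (repr r)).
Definition mq_opp (q : mquot) := mclass (pm_scale S (-1) (repr q)).
Definition mq_scale (a : A) (q : mquot) := mclass (pm_scale S a (repr q)).

Lemma mq_addE t u : mq_add (mclass t) (mclass u) = mclass (pm_add S t u).
Proof. by apply/mclass_eq/pm_add_congr; exact: mrepr_eq. Qed.

Lemma mq_scaleE a t : mq_scale a (mclass t) = mclass (pm_scale S a t).
Proof. by apply/mclass_eq/pm_scale_congr; exact: mrepr_eq. Qed.

Lemma mq_addA : associative mq_add.
Proof.
move=> q r s; rewrite -[q]mclass_repr -[r]mclass_repr -[s]mclass_repr !mq_addE.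
exact/mclass_eq/pm_addA.
Qed.

Lemma mq_addC : commutative mq_add.
Proof.
move=> q r; rewrite -[q]mclass_repr -[r]mclass_repr !mq_addE.
exact/mclass_eq/pm_addC.
Qed.

Lemma mq_add0 : left_id (mclass (pm_zero S)) mq_add.
Proof. by move=> q; rewrite -[q]mclass_repr mq_addE; exact/mclass_eq/pm_add0. Qed.

Lemma mq_addN : left_inverse (mclass (pm_zero S)) mq_opp mq_add.
Proof.
move=> q; rewrite -[q]mclass_repr -[mq_opp _]/(mq_scale (-1) _) mq_scaleE mq_addE.
exact/mclass_eq/pm_addN.
Qed.

HB.instance Definition _ :=
  GRing.isZmodule.Build mquot mq_addA mq_addC mq_add0 mq_addN.

Lemma mq_scaleA a b q : mq_scale a (mq_scale b q) = mq_scale (a * b) q.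
Proof. by rewrite -[q]mclass_repr !mq_scaleE; exact/mclass_eq/pm_scaleA. Qed.

Lemma mq_scale1 : left_id 1 mq_scale.
Proof.
by move=> q; rewrite -[q]mclass_repr mq_scaleE; exact/mclass_eq/pm_scale1.
Qed.

Lemma mq_scaleDr : right_distributive mq_scale +%R.
Proof.
move=> a q r; rewrite -[q]mclass_repr -[r]mclass_repr.
rewrite -[_ + _]/(mq_add _ _) -[RHS]/(mq_add _ _) !(mq_addE, mq_scaleE).
exact/mclass_eq/pm_scaleDr.
Qed.

Lemma mq_scaleDl q : {morph mq_scale^~ q : a b / a + b}.
Proof.
move=> a b; rewrite -[q]mclass_repr /= -[RHS]/(mq_add _ _) !(mq_addE, mq_scaleE).
exact/mclass_eq/pm_scaleDl.
Qed.

HB.instance Definition _ :=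
  GRing.Zmodule_isLmodule.Build A mquot mq_scaleA mq_scale1 mq_scaleDr mq_scaleDl.

Lemma mclassD t u : mclass (pm_add S t u) = mclass t + mclass u.
Proof. by rewrite -mq_addE. Qed.

Lemma mclassZ a t : mclass (pm_scale S a t) = a *: mclass t.
Proof. by rewrite -mq_scaleE. Qed.
End ModuleQuotient.

Section SubmoduleQuotient.
Variables (A : pzRingType) (M : lmodType A) (S : M -> Prop).
Hypotheses (S0 : S 0) (SD : forall x y, S x -> S y -> S (x + y))
  (SZ : forall a x, S x -> S (a *: x)).

Let S_eq x y : x = y -> S (x - y).
Proof. by move=> ->; rewrite subrr. Qed.

Definition submodule_premodule : premodule A M.
Proof.
apply: (@Premodule A M (fun x y => S (x - y)) 0 +%R *:%R).
- by move=> x; exact: S_eq.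
- by move=> x y /(SZ (-1)); rewrite scaleN1r opprB.
- by move=> x y z h1 h2; have := SD h1 h2; rewrite addrA subrK.
- by move=> x x' y y' h1 h2; have := SD h1 h2; rewrite addrACA opprD.
- by move=> a x y /(SZ a); rewrite scalerBr.
- by move=> x y z; apply: S_eq; rewrite addrA.
- by move=> x y; apply: S_eq; rewrite addrC.
- by move=> x; apply: S_eq; rewrite add0r.
- by move=> x; apply: S_eq; rewrite scaleN1r addNr.
- by move=> a b x; apply: S_eq; rewrite scalerA.
- by move=> x; apply: S_eq; rewrite scale1r.
- by move=> a x y; apply: S_eq; rewrite scalerDr.
by move=> a b x; apply: S_eq; rewrite scalerDl.
Defined.

Definition subquot : lmodType A := mquot submodule_premodule.
Definition subproj (x : M) : subquot := mclass submodule_premodule x.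

Lemma subproj_linear : linear subproj.
Proof.
move=> a x y; rewrite /subproj -mclassZ -mclassD.
by [].
Qed.

Lemma subproj_eq0 x : subproj x = 0 <-> S x.
Proof.
rewrite -[0]/(mclass submodule_premodule 0) mclass_eq /=.
by rewrite subr0.
Qed.

Lemma subproj_surj q : exists x, subproj x = q.
Proof. by exists (repr q); exact: mclass_repr. Qed.
End SubmoduleQuotient.

(** * Epimorphisms of comodules *)

Section ComoduleAlong.
Variables (H : hopf_algebroid) (M N : lmodType (base H)).
Variable h : M -> N.
Hypothesis hl : linear h.
Local Notation A := (base H).
Local Notation G := (coop H).
Local Notation scale M := (fun (a : A) (v : M) => a *: v).

Definition comap (t : cotens M) : cotens N := tmap (scale N) h t.

Lemma comapD : {morph comap : t u / t + u}.
Proof. by apply: tmapD; [exact: linear_morphD|exact: linear_scale]. Qed.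

Lemma comap_pure x v : comap (pure x v) = pure x (h v).
Proof. by apply: tmap_pure; [exact: linear_morphD|exact: linear_scale]. Qed.

Lemma tlift_comap (Z : zmodType) (f : G -> N -> Z) (t : cotens M) :
  balanced (ract (etaR H)) (scale N) f ->
  tlift f (comap t) = tlift (fun x v => f x (h v)) t.
Proof. exact: tlift_tmap. Qed.

Lemma comap_tlact a (t : cotens M) :
  comap (tlact (etaL H) a t) = tlact (etaL H) a (comap t).
Proof. by apply: tlact_tmap; [exact: linear_morphD|exact: linear_scale]. Qed.

Lemma counit_balanced (L : lmodType A) :
  balanced (ract (etaR H)) (scale L) (fun x v => counit H x *: v).
Proof.
split=> [y x x'|x y y'|x a y].
- by rewrite rmorphD scalerDl.
- by rewrite scalerDr.
by rewrite /ract rmorphM hopf_counitR scalerA.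
Qed.

Lemma comap_counit (t : cotens M) :
  h (tlift (fun x v => counit H x *: v) t) =
  tlift (fun x v => counit H x *: v) (comap t).
Proof.
rewrite tlift_comap; last exact: counit_balanced.
rewrite tlift_comp; last exact: linear_morphD.
by apply: eq_tlift => x v; rewrite linear_scale.
Qed.
End ComoduleAlong.

Lemma coact_tlact (H : hopf_algebroid) (M : gcomodule H) a (v : M) :
  coact (a *: v) = tlact (etaL H) a (coact v).
Proof. exact: coactZ. Qed.

Lemma comap_comp (H : hopf_algebroid) (L M N : lmodType (base H)) (g : M -> N)
    (f : L -> M) (t : cotens L) :
  linear g -> comap g (comap f t) = comap (fun v => g (f v)) t.
Proof.
move=> gl; rewrite {1}/comap /tmap; apply: tlift_comap.
by apply: tmap_balanced; [exact: linear_morphD|exact: linear_scale].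
Qed.

Section SurjectiveImage.
Variables (H : hopf_algebroid) (Y : gcomodule H) (Q : lmodType (base H)).
Variables (q : Y -> Q) (prQ : int -> Q -> Q) (coQ : Q -> cotens Q).
Hypotheses (ql : linear q) (qs : forall z, exists y, q y = z)
  (qpr : forall n y, prQ n (q y) = q (cm_pr n y))
  (qco : forall y, coQ (q y) = comap q (coact y)).

Let qD := linear_morphD ql.
Let qZ := linear_scale ql.

Lemma image_grading : is_grading prQ.
Proof.
have gY := @cm_grading _ Y.
split=> [n z z'|m n z|z].
- have [[y <-] [y' <-]] := (qs z, qs z').
  by rewrite -qD !qpr (gr_add gY) qD.
- have [y <-] := qs z; rewrite !qpr (gr_pr gY); case: ifP => // _.
  exact: madd0 qD.
have [y <-] := qs z; have [s us [ey _]] := gr_support gY y; exists s => //.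
by rewrite {1}ey (madd_sum qD); apply: eq_bigr => n _; rewrite qpr.
Qed.

Lemma image_homog_lift n z : homog prQ n z ->
  exists2 y, homog (@cm_pr _ Y) n y & q y = z.
Proof.
have [y <-] := qs z; rewrite /homog qpr => e.
by exists (cm_pr n y) => //; exact: (homog_pr (@cm_grading _ Y)).
Qed.

Lemma image_homog n y : homog (@cm_pr _ Y) n y -> homog prQ n (q y).
Proof. by rewrite /homog qpr => ->. Qed.

(** Each axiom is tested on elements [q y]. Homogeneous elements lift to homogeneous ones because
    [q] commutes with the projections. *)
Definition image_comodule : gcomodule H.
Proof.
apply: (@GComodule H Q prQ image_grading _ coQ).
- move=> m n a z ha /image_homog_lift[y hy <-]; rewrite -qZ.
  by apply: image_homog; exact: cm_scale.
- move=> z z'; have [[y <-] [y' <-]] := (qs z, qs z').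
  by rewrite -qD !qco coactD comapD.
- move=> a z; have [y <-] := qs z; rewrite -qZ !qco coact_tlact.
  exact: comap_tlact.
- move=> n z /image_homog_lift[y hy <-]; rewrite qco; apply: thomog_tmap.
  + exact: qD.
  + exact: qZ.
  + by move=> m v; exact: image_homog.
  by apply: coact_homog.
- move=> z; have [y <-] := qs z.
  by rewrite qco -comap_counit // coact_counit.
move=> z; have [y <-] := qs z; rewrite qco.
rewrite -(tmap_coassocR _ qD qZ) -(coact_coassoc y); symmetry.
apply: tmap_coassocL => // [v w|a v].
  have [[y1 <-] [y2 <-]] := (qs v, qs w).
  by rewrite -qD !qco coactD comapD.
have [y1 <-] := qs v; rewrite -qZ !qco coact_tlact.
exact: comap_tlact.
Defined.

Lemma image_connective : connective Y -> connective image_comodule.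
Proof.
move=> cY n z n0 hz; have [y hy <-] := @image_homog_lift n z hz.
by rewrite (cY n y n0 hy) (madd0 qD).
Qed.

Lemma image_hom : @is_comod_hom H Y image_comodule q.
Proof. by split. Qed.
End SurjectiveImage.

Section Epimorphisms.
Variable H : hopf_algebroid.

Lemma comod_zero_hom (M N : gcomodule H) : @is_comod_hom H M N (fun=> 0).
Proof.
split=> [a u v|n v|v].
- by rewrite scaler0 addr0.
- by rewrite (gr0 (@cm_grading _ N)).
rewrite (madd0 (@coactD _ N)) /tlift /feval big1 // => xy _.
exact: pure0r.
Qed.

Lemma conn_hom_ext (X Y : connective_comodules H) (f g : Defs.hom X Y) :
  (forall x, sval f x = sval g x) -> f = g.
Proof.
by case: f g => [f hf] [g hg] e; apply: eq_exist; apply/funext; exact: e.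
Qed.

Lemma surj_epi (X Y : connective_comodules H) (f : Defs.hom X Y) :
  (forall y, exists x, sval f x = y) -> epi f.
Proof.
move=> fs Z g h e; apply: conn_hom_ext => y.
by have [x <-] := fs y; have := congr1 (fun k => sval k x) e.
Qed.

Lemma epi_surj (X Y : connective_comodules H) (f : Defs.hom X Y) :
  epi f -> forall y, exists x, sval f x = y.
Proof.
case: Y f => Y cY f0 ef y.
have hf := svalP f0; pose f : sval X -> Y := sval f0.
rewrite /= -/f in hf y *.
have fD := comod_homD hf; have fZ := comod_homZ hf.
have [_ fpr fco] := hf.
pose S (y : Y) := exists x, f x = y.
have S0 : S 0 by exists 0; exact: madd0 fD.
have SD y1 y2 : S y1 -> S y2 -> S (y1 + y2).
  by move=> [x1 <-] [x2 <-]; exists (x1 + x2).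
have SZ a y1 : S y1 -> S (a *: y1) by move=> [x1 <-]; exists (a *: x1).
pose q := subproj S0 SD SZ.
have ql : linear q by exact: subproj_linear.
have qs : forall z, exists y, q y = z by exact: subproj_surj.
have qD := linear_morphD ql.
(* Compose [g] with a choice of preimages: two preimages differ by an element of the image of [f],
   which [g] kills. This yields the projections and the coaction of the cokernel. *)
have descend (Z : zmodType) (g : Y -> Z) :
    {morph g : y1 y2 / y1 + y2} -> (forall x, g (f x) = 0) ->
    exists gq, forall y, gq (q y) = g y.
  move=> gD gf; have [r rP] := choice qs.
  exists (g \o r) => y1 /=; apply/eqP; rewrite -subr_eq0 -(maddB gD); apply/eqP.
  have /subproj_eq0 [x <-] // : subproj S0 SD SZ (r (q y1) - y1) = 0.
  by rewrite -/q (maddB qD) rP subrr.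
have qf x : q (f x) = 0 by apply/subproj_eq0; exists x.
have /choice[prQ qpr] : forall n : int,
    exists prQ : subquot S0 SD SZ -> subquot S0 SD SZ,
    forall y, prQ (q y) = q (cm_pr n y).
  move=> n; apply: descend => [y1 y2|x]; last by rewrite -fpr.
  by rewrite (gr_add (@cm_grading _ Y)) qD.
have [coQ qco] : exists coQ, forall y, coQ (q y) = comap q (coact y).
  apply: descend => [y1 y2|x]; first by rewrite coactD comapD.
  rewrite fco -[X in comap q X]/(comap f (coact x)) comap_comp //.
  by rewrite /comap /tmap /tlift /feval big1 // => xy _; rewrite qf pure0r.
pose Q := image_comodule ql qs qpr qco.
have cQ : connective Q by exact: image_connective.
pose g : @Defs.hom (connective_comodules H) (exist _ Y cY) (exist _ Q cQ) :=
  exist _ q (image_hom ql qs qpr qco).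
pose z : @Defs.hom (connective_comodules H) (exist _ Y cY) (exist _ Q cQ) :=
  exist _ (fun=> 0) (comod_zero_hom Y Q).
have gz : g = z.
  by apply: ef; apply: conn_hom_ext => x /=; rewrite qf.
have /subproj_eq0 // : subproj S0 SD SZ y = 0.
by have := congr1 (fun k => sval k y) gz.
Qed.
End Epimorphisms.

(** * Free connective comodules *)

Section FreeComodule.
Variables (H : hopf_algebroid) (K : right_coordinates H).
Variables (V : Type) (deg : V -> int).
Local Notation A := (base H).
Local Notation G := (coop H).

(* A graded comodule is a module with the operations [cm_pr n] and [theta i];
   the free connective comodule on [V] consists of the terms in these
   operations, two terms being equal when they agree at every assignment of the
   variables in every connective comodule. *)
Inductive term :=
| TVar of V
| TZero
| TAdd of term & term
| TScale of A & term
| TOp of rc_index K & term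
| TPr of int & term.

HB.instance Definition _ := gen_eqMixin term.
HB.instance Definition _ := gen_choiceMixin term.

Record point := Point {
  pt_mod :> gcomodule H;
  pt_conn : connective pt_mod;
  pt_val : V -> pt_mod;
  pt_homog : forall x, homog (@cm_pr _ pt_mod) (deg x) (pt_val x)
}.

Implicit Types (p q : point) (t u : term).

Fixpoint eval (p : point) (t : term) : p :=
  match t with
  | TVar x => pt_val p x
  | TZero => 0
  | TAdd t u => eval p t + eval p u
  | TScale a t => a *: eval p t
  | TOp i t => theta i (eval p t)
  | TPr n t => cm_pr n (eval p t)
  end.

Lemma eval_hom (p q : point) (h : p -> q) : is_comod_hom h ->
  (forall x, h (pt_val p x) = pt_val q x) -> forall t, h (eval p t) = eval q t.
Proof.
move=> hh hv; have hD := comod_homD hh; have hZ := comod_homZ hh.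
elim=> //= [|t <- u <-|a t <-|i t <-|n t <-] //.
- exact: madd0 hD.
- exact: comod_hom_theta.
by have [_ ->] := hh.
Qed.

(** The order of quantifiers is the point: the bound comes from the syntax alone, so one finite set
    of basis elements serves every assignment. *)
Lemma eval_bound t : exists N : int,
  forall p : point, deg_le (@cm_pr _ p) N (eval p t).
Proof.
have gM (p : point) := @cm_grading _ p.
elim: t => [x||t [N hN] u [N' hN']|a t [N hN]|i t [N hN]|n t _].
- by exists (deg x) => p; apply: homog_deg_le => //; exact: pt_homog.
- by exists 0 => p; exact: deg_le0.
- exists (Num.max N N') => p; apply: deg_leD => //.
    by apply: deg_leW (hN p); rewrite le_max lexx.
  by apply: deg_leW (hN' p); rewrite le_max lexx orbT.
- have [N' hN'] := deg_le_exists (@gpr_grading A) a; exists (N'%:Z + N) => p.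
  by apply: deg_le_scale => //; exact: cm_scale.
- exists (N - rc_deg i) => p m Nm /=.
  rewrite theta_pr hN ?(madd0 (@thetaD _ _ _ i)) //.
  by rewrite -ltrBlDr.
by exists n => p; apply: homog_deg_le => //; exact: homog_pr.
Qed.

Definition term_premodule : premodule A term.
Proof.
apply: (@Premodule A term (fun t u => forall p, eval p t = eval p u)
  TZero TAdd TScale).
- by [].
- by move=> t u h p; rewrite h.
- by move=> t u v h1 h2 p; rewrite h1.
- by move=> t t' u u' h1 h2 p /=; rewrite h1 h2.
- by move=> a t t' h p /=; rewrite h.
- by move=> t u v p /=; rewrite addrA.
- by move=> t u p /=; rewrite addrC.
- by move=> t p /=; rewrite add0r.
- by move=> t p /=; rewrite scaleN1r addNr.
- by move=> a b t p /=; rewrite scalerA.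
- by move=> t p /=; rewrite scale1r.
- by move=> a t u p /=; rewrite scalerDr.
by move=> a b t p /=; rewrite scalerDl.
Defined.

Definition fmod : lmodType A := mquot term_premodule.
Definition fclass (t : term) : fmod := mclass term_premodule t.
Definition ev (p : point) (y : fmod) : p := eval p (repr y).

Lemma ev_class p t : ev p (fclass t) = eval p t.
Proof. exact: (mrepr_eq term_premodule t p). Qed.

Lemma fclass_surj y : exists t, fclass t = y.
Proof. by exists (repr y); exact: mclass_repr. Qed.

Lemma ev_ext y z : (forall p, ev p y = ev p z) -> y = z.
Proof.
have [[t <-] [u <-]] := (fclass_surj y, fclass_surj z) => h.
by apply/mclass_eq => p; rewrite -!ev_class h.
Qed.

Lemma ev_linear p : linear (ev p).
Proof.
move=> a y z; have [[t <-] [u <-]] := (fclass_surj y, fclass_surj z).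
have -> : a *: fclass t + fclass u = fclass (TAdd (TScale a t) u).
  by rewrite /fclass -mclassZ -mclassD.
by rewrite !ev_class.
Qed.

Let evD p := linear_morphD (@ev_linear p).
Let evZ p := linear_scale (@ev_linear p).

Definition fpr (n : int) (y : fmod) : fmod := fclass (TPr n (repr y)).
Definition fop (i : rc_index K) (y : fmod) : fmod := fclass (TOp i (repr y)).
Definition fvar (x : V) : fmod := fclass (TVar x).

Lemma ev_pr p n y : ev p (fpr n y) = cm_pr n (ev p y).
Proof. by rewrite ev_class. Qed.

Lemma ev_op p i y : ev p (fop i y) = theta i (ev p y).
Proof. by rewrite ev_class. Qed.

Lemma ev_var p x : ev p (fvar x) = pt_val p x.
Proof. by rewrite ev_class. Qed.

Lemma fhomogP n y :
  homog fpr n y <-> forall p, homog (@cm_pr _ p) n (ev p y).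
Proof.
split=> [h p|h]; first by rewrite /homog -ev_pr h.
by apply: ev_ext => p; rewrite ev_pr h.
Qed.

Lemma ev_bound y : exists N : nat,
  forall p : point, deg_le (@cm_pr _ p) N%:Z (ev p y).
Proof.
have [t <-] := fclass_surj y; have [N hN] := eval_bound t.
exists `|N|%N => p; rewrite ev_class; apply: deg_leW (hN p).
by rewrite abszE ler_norm.
Qed.

Lemma fpr_grading : is_grading fpr.
Proof.
have gM (p : point) := @cm_grading _ p.
split=> [n y z|m n y|y].
- by apply: ev_ext => p; rewrite evD !ev_pr evD (gr_add (gM p)).
- apply: ev_ext => p; rewrite !ev_pr (gr_pr (gM p)).
  by case: ifP => _; rewrite ?ev_pr // (madd0 (@evD p)).
(* Degrees 0 to [N] suffice at all points simultaneously: connectivity handles those below, the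
   uniform bound those above. *)
have [N hN] := ev_bound y; pose s := [seq n%:Z | n <- iota 0 N.+1].
have us : uniq s by rewrite map_inj_uniq ?iota_uniq // => a b [].
exists s => //; apply: ev_ext => p; rewrite (madd_sum (@evD p)).
under eq_bigr => n _ do rewrite ev_pr.
apply: gr_sum => // n ns; have [n0|] := ltP n 0.
  by apply: conn_neg => //; exact: pt_conn.
case: n ns => // n ns _; apply: hN; rewrite ltz_nat ltnNge.
by apply: contra ns => nN; apply/mapP; exists n => //; rewrite mem_iota.
Qed.

(** The coordinates of a tensor lie in [fmod] itself, where evaluations separate elements, and
    evaluation commutes with taking coordinates. *)
Lemma comap_ev_inj (x y : cotens fmod) :
  (forall p, comap (ev p) x = comap (ev p) y) -> x = y.
Proof.
move=> e; apply: (tcoord_inj (K := K) (laction_scale fmod)) => i.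
apply: ev_ext => p.
have nat v : ev p (tcoord i v) = tcoord i (comap (ev p) v).
  by rewrite (tcoord_tmap (laction_scale _) (laction_scale _) (@evD p) (@evZ p)).
by rewrite !nat e.
Qed.

(** The same argument one tensor factor higher, where coassociativity lives; the coordinates now lie
    in [cotens fmod]. *)
Lemma comap_ev_inj2
    (x y : tens (ract (etaR H)) (@tlact A G (etaL H) (etaR H) fmod *:%R)) :
  (forall p, tmap (tlact (etaL H) (la := *:%R)) (comap (ev p)) x =
             tmap (tlact (etaL H) (la := *:%R)) (comap (ev p)) y) -> x = y.
Proof.
move=> e; apply: (tcoord_inj (K := K) (laction_tlact _)) => i.
apply: comap_ev_inj => p.
have nat (v : tens (ract (etaR H)) (@tlact A G (etaL H) (etaR H) fmod *:%R)) :
    comap (ev p) (tcoord i v) =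
    tcoord i (tmap (tlact (etaL H) (la := *:%R)) (comap (ev p)) v).
  symmetry; apply: tcoord_tmap; [exact: laction_tlact..| |].
    exact: comapD (@ev_linear p).
  by move=> a z; exact: comap_tlact (@ev_linear p) a z.
by rewrite !nat e.
Qed.

(** The sum runs over a list depending on a chosen bound, so it is not visibly additive in [y]. Its
    evaluations determine it, and the comodule axioms are deduced from them. *)
Lemma fcoact_exists y : exists psi : cotens fmod,
  (forall p, comap (ev p) psi = coact (ev p y)) /\
  (forall n, homog fpr n y -> thomog (@gpr G) fpr n psi).
Proof.
have [N hN] := ev_bound y; have [L uL hL] := rc_fin K N.
exists (\sum_(i <- L) pure (rc_f i) (fop i y)); split=> [p|n /fhomogP hy].
  rewrite (madd_sum (comapD (@ev_linear p))).
  have [s us [s0 ->]] := tcoord_expand K (laction_scale p) (coact (ev p y)).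
  under eq_bigr => i _ do rewrite (comap_pure (@ev_linear p)) ev_op.
  apply: big_uniq_support => // i.
    (* Off [L], either the operation lands in negative degrees or the coordinate is identically
       zero. *)
    move=> /hL[Ni|ci]; first by rewrite (theta_bound (@pt_conn p) (hN p)) // pure0r.
    rewrite /theta /tcoord /tlift /feval big1 ?pure0r // => xy _.
    by rewrite ci scale0r.
  by rewrite /theta => /s0 ->; rewrite pure0r.
exists [seq (rc_f i, fop i y) | i <- L]; first by rewrite big_map.
move=> _ /mapP[i _ ->]; exists (rc_deg i), (n - rc_deg i).
split; [by rewrite subrKC|exact: rc_f_homog|].
by apply/fhomogP => p; rewrite ev_op; exact: theta_homog.
Qed.

Definition fcoact (y : fmod) : cotens fmod := sval (cid (fcoact_exists y)).

Lemma ev_coact p y : comap (ev p) (fcoact y) = coact (ev p y).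
Proof. by have [h _] := svalP (cid (fcoact_exists y)). Qed.

Lemma fcoact_homog n y : homog fpr n y -> thomog (@gpr G) fpr n (fcoact y).
Proof. by have [_] := svalP (cid (fcoact_exists y)); exact. Qed.

Lemma fcoactD : {morph fcoact : y z / y + z}.
Proof.
move=> y z; apply: comap_ev_inj => p.
by rewrite (comapD (@ev_linear p)) !ev_coact evD coactD.
Qed.

Lemma fcoactZ a y : fcoact (a *: y) = tlact (etaL H) a (fcoact y).
Proof.
apply: comap_ev_inj => p; rewrite (comap_tlact (@ev_linear p)) !ev_coact evZ.
exact: coact_tlact.
Qed.

Definition free_comodule : gcomodule H.
Proof.
apply: (@GComodule H fmod fpr fpr_grading _ fcoact fcoactD fcoactZ
  (@fcoact_homog)).
- move=> m n a y ha /fhomogP hy; apply/fhomogP => p; rewrite evZ.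
  exact: cm_scale.
- move=> y; apply: ev_ext => p.
  by rewrite (comap_counit (@ev_linear p)) ev_coact coact_counit.
move=> y; apply: comap_ev_inj2 => p.
rewrite (tmap_coassocR _ (@evD p) (@evZ p)).
rewrite -/(comap _ _) ev_coact -(coact_coassoc (ev p y)) -ev_coact.
apply: tmap_coassocL => [||||v].
- exact: evD.
- exact: evZ.
- exact: coactD.
- exact: coact_tlact.
by rewrite -ev_coact.
Defined.

Lemma free_connective : connective free_comodule.
Proof.
move=> n y n0 /fhomogP hy; apply: ev_ext => p; rewrite (madd0 (@evD p)).
exact: (pt_conn n0 (hy p)).
Qed.

Lemma ev_hom p : @is_comod_hom H free_comodule p (ev p).
Proof.
split; [exact: ev_linear|by move=> n y; rewrite ev_pr|].
by move=> y; rewrite -ev_coact.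
Qed.

Lemma fvar_homog x : homog fpr (deg x) (fvar x).
Proof. by apply/fhomogP => p; rewrite ev_var; exact: pt_homog. Qed.

Definition free_point : point :=
  @Point free_comodule free_connective fvar fvar_homog.

(** The free comodule is itself a point, with the variables as tautological assignment. Together
    with [eval_hom] this shows that a morphism out of it is determined on the variables. *)
Lemma eval_free t : eval free_point t = fclass t.
Proof.
apply: ev_ext => p; rewrite ev_class; apply: (eval_hom (p := free_point)).
  exact: ev_hom.
exact: ev_var.
Qed.

Definition free_object : connective_comodules H :=
  exist _ free_comodule free_connective.

Lemma free_projective : projective free_object.
Proof.
move=> X Y e f /epi_surj es; have [he hf] := (svalP e, svalP f).
have [_ epr _] := he; have [_ fprE _] := hf.
have /choice[rho rhoP] : forall x : V, exists w : sval X,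
    homog (@cm_pr _ (sval X)) (deg x) w /\ sval e w = sval f (fvar x).
  move=> x; have [w ew] := es (sval f (fvar x)).
  (* The component of degree [deg x] is still a preimage, since [e] preserves degrees and the target
     is homogeneous of that degree. *)
  exists (cm_pr (deg x) w); split; first exact: homog_pr (@cm_grading _ _) _ _.
  by rewrite epr ew -fprE; congr (sval f _); exact: fvar_homog.
pose p := @Point (sval X) (svalP X) rho (fun x => proj1 (rhoP x)).
have fhom x : homog (@cm_pr _ (sval Y)) (deg x) (sval f (fvar x)).
  by rewrite /homog -fprE; congr (sval f _); exact: fvar_homog.
pose q := @Point (sval Y) (svalP Y) _ fhom.
exists (exist _ (ev p) (ev_hom p)); apply: conn_hom_ext => y.
have [t <-] := fclass_surj y; rewrite /= ev_class -eval_free.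
(* Both morphisms send the class of [t] to the value of [t] at [q]. *)
rewrite (@eval_hom p q (sval e) he) => [|x]; last by have [_] := rhoP x.
by rewrite (@eval_hom free_point q (sval f) hf).
Qed.
End FreeComodule.

Lemma enough_projectives (H : hopf_algebroid) :
  right_coordinates H -> has_enough_projectives (connective_comodules H).
Proof.
move=> K X; pose M := sval X; have gM := @cm_grading _ M.
(* One variable for each pair of a degree [n] and an element [v], with value the component of [v] in
   degree [n]; homogeneity is then automatic. *)
pose deg (x : int * M) := x.1.
pose p := @Point H _ deg M (svalP X) _ (fun x => homog_pr gM x.1 x.2).
exists (free_object K deg), (exist _ (@ev H K _ deg p) (ev_hom K p)).
split; first exact: free_projective.
apply: surj_epi => v; have [s us [-> _]] := gr_support gM v.
exists (\sum_(n <- s) fvar K deg (n, v)).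
rewrite /= (madd_sum (linear_morphD (@ev_linear _ K _ _ p))).
by apply: eq_bigr => n _; rewrite ev_var.
Qed.

(** * The sum of the shifts of the base *)

Section ShiftedSum.
Variable H : hopf_algebroid.
Local Notation A := (base H).
Local Notation G := (coop H).
Hypothesis A_neg : forall n (a : A), n < 0 -> gpr n a = 0.

Let gA := @gpr_grading A.

Definition seq_add (s t : seq A) : seq A :=
  mkseq (fun k => s`_k + t`_k) (maxn (size s) (size t)).
Definition seq_scale (a : A) (s : seq A) : seq A := [seq a * x | x <- s].

Lemma nth_mkseq0 (f : nat -> A) N k :
  (forall k, (N <= k)%N -> f k = 0) -> (mkseq f N)`_k = f k.
Proof.
move=> f0; have [kN|Nk] := ltnP k N; first by rewrite nth_mkseq.
by rewrite nth_default ?size_mkseq // f0.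
Qed.

Lemma nth_seq_add s t k : (seq_add s t)`_k = s`_k + t`_k.
Proof.
apply: nth_mkseq0 => {}k; rewrite geq_max => /andP[hs ht].
by rewrite !nth_default ?addr0.
Qed.

Lemma nth_seq_scale a s k : (seq_scale a s)`_k = a * s`_k.
Proof.
have [ks|sk] := ltnP k (size s); first by rewrite (nth_map 0).
by rewrite !nth_default ?mulr0 ?size_map.
Qed.

Definition coef_premodule : premodule A (seq A).
Proof.
apply: (@Premodule A (seq A) (fun s t => forall k, s`_k = t`_k) [::]
  seq_add seq_scale).
- by [].
- by move=> s t h k; rewrite h.
- by move=> s t u h1 h2 k; rewrite h1.
- by move=> s s' t t' h1 h2 k; rewrite !nth_seq_add h1 h2.
- by move=> a s s' h k; rewrite !nth_seq_scale h.
- by move=> s t u k; rewrite !nth_seq_add addrA.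
- by move=> s t k; rewrite !nth_seq_add addrC.
- by move=> s k; rewrite nth_seq_add nth_nil add0r.
- by move=> s k; rewrite nth_seq_add nth_seq_scale mulN1r addNr nth_nil.
- by move=> a b s k; rewrite !nth_seq_scale mulrA.
- by move=> s k; rewrite nth_seq_scale mul1r.
- by move=> a s t k; rewrite !(nth_seq_add, nth_seq_scale) mulrDr.
by move=> a b s k; rewrite !(nth_seq_add, nth_seq_scale) mulrDl.
Defined.

(* The direct sum over [k >= 0] of copies of [A] shifted up by [k], with
   primitive generators; an element is its sequence of coefficients up to
   trailing zeros. *)
Definition shsum : lmodType A := mquot coef_premodule.
Definition coef (k : nat) (b : shsum) : A := (repr b)`_k.
Definition of_coefs (f : nat -> A) (N : nat) : shsum :=
  mclass coef_premodule (mkseq f N).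

Lemma coef_class k s : coef k (mclass coef_premodule s) = s`_k.
Proof. exact: (mrepr_eq coef_premodule s k). Qed.

Lemma coef_ext b c : (forall k, coef k b = coef k c) -> b = c.
Proof. by move=> e; rewrite -[b]mclass_repr -[c]mclass_repr; apply/mclass_eq. Qed.

Lemma coefD k : {morph coef k : b c / b + c}.
Proof.
move=> b c; rewrite -[b in LHS]mclass_repr -[c in LHS]mclass_repr -mclassD.
by rewrite coef_class /= nth_seq_add.
Qed.

Lemma coefZ k a b : coef k (a *: b) = a * coef k b.
Proof. by rewrite -[b in LHS]mclass_repr -mclassZ coef_class /= nth_seq_scale. Qed.

Lemma coef0 k : coef k 0 = 0.
Proof. exact: madd0 (coefD k). Qed.

Lemma coef_large b : exists N, forall k, (N <= k)%N -> coef k b = 0.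
Proof. by exists (size (repr b)) => k h; rewrite /coef nth_default. Qed.

Lemma coef_of f N k :
  (forall k, (N <= k)%N -> f k = 0) -> coef k (of_coefs f N) = f k.
Proof. by move=> f0; rewrite coef_class nth_mkseq0. Qed.

Definition gen (k : nat) : shsum := of_coefs (fun j => (j == k)%:R) k.+1.

Lemma coef_gen j k : coef j (gen k) = (j == k)%:R.
Proof. by apply: coef_of => {}j; case: eqP => // ->; rewrite ltnn. Qed.

Lemma gen_expand b N : (forall k, (N <= k)%N -> coef k b = 0) ->
  b = \sum_(0 <= k < N) coef k b *: gen k.
Proof.
move=> b0; apply: coef_ext => j; rewrite (madd_sum (coefD j)).
have [jN|Nj] := ltnP j N.
  rewrite (bigD1_seq j) ?mem_index_iota ?iota_uniq //= coefZ coef_gen eqxx mulr1.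
  rewrite big1 ?addr0 // => k kj.
  by rewrite coefZ coef_gen eq_sym (negbTE kj) mulr0.
rewrite b0 // big_seq big1 // => k; rewrite mem_index_iota => /andP[_ kN].
by rewrite coefZ coef_gen gtn_eqF ?mulr0 // (leq_trans kN).
Qed.

Lemma shsum_ext (Z : zmodType) (F F' : shsum -> Z) :
  {morph F : b c / b + c} -> {morph F' : b c / b + c} ->
  (forall k a, F (a *: gen k) = F' (a *: gen k)) -> forall b, F b = F' b.
Proof.
move=> FD FD' e b; have [N b0] := coef_large b.
by rewrite (gen_expand b0) !madd_sum //; apply: eq_bigr.
Qed.

(** The shift by [k] appears because [gen k] has degree [k]. *)
Definition shpr (n : int) (b : shsum) : shsum :=
  of_coefs (fun k => gpr (n - k%:Z) (coef k b)) (size (repr b)).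

Lemma coef_pr k n b : coef k (shpr n b) = gpr (n - k%:Z) (coef k b).
Proof.
by apply: coef_of => {}k h; rewrite /coef nth_default // (gr0 gA).
Qed.

Lemma shpr_homogP n b :
  homog shpr n b <-> forall k, homog (@gpr A) (n - k%:Z) (coef k b).
Proof.
split=> [h k|h]; first by rewrite /homog -coef_pr h.
by apply: coef_ext => k; rewrite coef_pr h.
Qed.

Lemma shpr_grading : is_grading shpr.
Proof.
split=> [n b c|m n b|b].
- by apply: coef_ext => k; rewrite coefD !coef_pr coefD (gr_add gA).
- apply: coef_ext => k; rewrite !coef_pr (gr_pr gA) (inj_eq (addIr _)).
  by case: ifP; rewrite ?coef_pr ?coef0.
have [N b0] := coef_large b.
have /choice[d hd] : forall k, exists d : nat, deg_le (@gpr A) d%:Z (coef k b).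
  by move=> k; exact: deg_le_exists gA _.
(* A coefficient of degree at most [d k] contributes in degree at most [d k + k]. *)
pose M := (\max_(0 <= k < N) (d k + k))%N.
pose s := [seq n%:Z | n <- iota 0 M.+1].
have us : uniq s by rewrite map_inj_uniq ?iota_uniq // => i j [].
exists s => //; apply: coef_ext => k.
rewrite (madd_sum (coefD k)); under eq_bigr => n _ do rewrite coef_pr.
have [Nk|kN] := leqP N k.
  by rewrite b0 // big1 // => n _; rewrite (gr0 gA).
pose s' := [seq n - k%:Z | n <- s].
rewrite -(big_map (fun n => n - k%:Z) xpredT (fun n => gpr n (coef k b))) -/s'.
apply: (gr_sum gA) => [|n].
  by rewrite /s' map_inj_uniq // => i j; exact: addIr.
apply: contraNeq => nz; apply/mapP; exists (n + k%:Z); last by rewrite addrK.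
have n0 : 0 <= n by rewrite leNgt; apply: contraNN nz => /A_neg ->.
have nd : n <= (d k)%:Z by rewrite leNgt; apply: contraNN nz => /hd ->.
case: n n0 nd {nz} => // n _; rewrite lez_nat => nd.
apply/mapP; exists (n + k)%N => //; rewrite mem_iota /= add0n ltnS.
apply: (@leq_trans (d k + k)); first by rewrite leq_add2r.
apply: (@leq_bigmax_seq _ _ xpredT (fun k => (d k + k)%N)) => //.
by rewrite mem_index_iota.
Qed.

(** Primitivity means that [gen k] goes to [pure 1 (gen k)]. The length of the representative is
    merely a cutoff, by [shcoactE]. *)
Definition shcoact (b : shsum) : cotens shsum :=
  \sum_(0 <= k < size (repr b)) pure (etaL H (coef k b)) (gen k).

Lemma shcoactE b N : (forall k, (N <= k)%N -> coef k b = 0) ->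
  shcoact b = \sum_(0 <= k < N) pure (etaL H (coef k b)) (gen k).
Proof.
move=> b0; apply: big_uniq_support; rewrite ?iota_uniq // => k.
  rewrite mem_index_iota /= -leqNgt => h.
  by rewrite /coef nth_default // rmorph0 pure0l.
by rewrite mem_index_iota /= -leqNgt => /b0 ->; rewrite rmorph0 pure0l.
Qed.

Lemma shcoactD : {morph shcoact : b c / b + c}.
Proof.
move=> b c; have [[N b0] [N' c0]] := (coef_large b, coef_large c).
have b0' k : (maxn N N' <= k)%N -> coef k b = 0.
  by rewrite geq_max => /andP[/b0].
have c0' k : (maxn N N' <= k)%N -> coef k c = 0.
  by rewrite geq_max => /andP[_ /c0].
rewrite (shcoactE b0') (shcoactE c0') (@shcoactE _ (maxn N N')) => [|k h].
  by rewrite -big_split; apply: eq_bigr => k _; rewrite coefD rmorphD pureDl.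
by rewrite coefD b0' // c0' // addr0.
Qed.

Lemma shcoact_gen k a : shcoact (a *: gen k) = pure (etaL H a) (gen k).
Proof.
rewrite (@shcoactE _ k.+1) => [|j h]; last first.
  by rewrite coefZ coef_gen gtn_eqF ?mulr0.
rewrite big_nat_recr //= big_nat big1 ?add0r => [|j /andP[_ h]].
  by rewrite coefZ coef_gen eqxx mulr1.
by rewrite coefZ coef_gen ltn_eqF // mulr0 rmorph0 pure0l.
Qed.

Lemma shcoactZ a b : shcoact (a *: b) = tlact (etaL H) a (shcoact b).
Proof.
move: b; apply: shsum_ext => [b c|b c|k c].
- by rewrite scalerDr shcoactD.
- by rewrite shcoactD; apply: tlift_morph; exact: tlact_balanced.
by rewrite scalerA !shcoact_gen rmorphM tlact_pure.
Qed.

Lemma gen_homog k : homog shpr k%:Z (gen k).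
Proof.
apply/shpr_homogP => j; rewrite coef_gen; case: eqP => [->|_].
  by rewrite subrr; exact: gpr_one.
exact: homog0 gA _.
Qed.

Definition shcomod : gcomodule H.
Proof.
apply: (@GComodule H shsum shpr shpr_grading _ shcoact shcoactD shcoactZ).
- move=> m n a b ha /shpr_homogP hb; apply/shpr_homogP => k.
  by rewrite coefZ -addrA; exact: gpr_mul.
- move=> n b /shpr_homogP hb.
  exists [seq (etaL H (coef k b), gen k) | k <- iota 0 (size (repr b))].
    by rewrite big_map /shcoact /index_iota subn0.
  move=> _ /mapP[k _ ->]; exists (n - k%:Z), k%:Z.
  split; [by rewrite subrK|exact: gcm_homog|exact: gen_homog].
- apply: shsum_ext => // [b c|k a].
    by rewrite shcoactD; apply: tlift_morph; exact: counit_balanced.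
  rewrite shcoact_gen (tlift_pure _ _ (counit_balanced shsum)).
  by rewrite hopf_counitL.
have hL := tmap_balanced (ract (etaR H)) shcoactD shcoactZ.
apply: shsum_ext => [b c|b c|k a].
- by rewrite shcoactD; exact: tlift_morph.
- by rewrite shcoactD; apply: tlift_morph; exact: coassoc_balanced.
(* On [a *: gen k] both sides reduce to [pure (etaL H a) (pure 1 (gen k))], because [Delta (etaL a)]
   is [pure (etaL a) 1]. *)
rewrite shcoact_gen (tlift_pure _ _ hL).
rewrite (tlift_pure _ _ (coassoc_balanced (fun (a : A) (v : shsum) => a *: v))).
rewrite -[gen k in LHS]scale1r shcoact_gen rmorph1.
rewrite -[etaL H a in RHS]mulr1 hopf_DeltaL hopf_Delta1.
rewrite -[X in tlift _ X]/(tlact (etaL H) a _) tlact_pure mulr1.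
by rewrite (tlift_pure _ _ (comult_balanced _ _)).
Defined.
End ShiftedSum.

(* The [e k] behave like the projections of an object onto the summands of a
   decomposition that is both a coproduct and a product. *)
Definition biproduct_projections (C : category) (B : C)
    (e : nat -> Defs.hom B B) : Prop :=
  [/\ forall (Z : C) (z : nat -> Defs.hom Z B),
        exists b : Defs.hom Z B,
          forall k, Defs.comp (e k) b = Defs.comp (e k) (z k),
      forall (Z : C) (g h : Defs.hom B Z),
        (forall k, Defs.comp g (e k) = Defs.comp h (e k)) -> g = h,
      forall k l, k <> l -> forall (Z : C) (g h : Defs.hom Z B),
        Defs.comp (e k) (Defs.comp (e l) g) =
        Defs.comp (e k) (Defs.comp (e l) h)
    & forall k, exists (Z : C) (g h : Defs.hom Z B),
        Defs.comp (e k) g <> Defs.comp (e k) h].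

(** * The sum of shifts is also their product *)

Section ShiftedSumProjections.
Variables (H : hopf_algebroid) (K : right_coordinates H).
Local Notation A := (base H).
Hypothesis A_neg : forall n (a : A), n < 0 -> gpr n a = 0.
Hypothesis A_nontrivial : 1 <> 0 :> A.

Local Notation B := (shcomod A_neg).

Lemma shcomod_connective : connective B.
Proof.
move=> n b n0 /shpr_homogP hb; apply: coef_ext => k.
rewrite coef0 -(hb k) A_neg //; apply: le_lt_trans n0.
by rewrite gerBl.
Qed.

Definition shproj (k : nat) (b : B) : B := coef k b *: (gen H k : B).

Lemma coef_proj j k b : coef j (shproj k b) = if j == k then coef k b else 0.
Proof. by rewrite coefZ coef_gen; case: eqP => _; rewrite ?mulr1 ?mulr0. Qed.

Lemma shproj_linear k : linear (shproj k).
Proof. by move=> a b c; rewrite /shproj coefD coefZ scalerDl scalerA. Qed.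

Lemma shproj_gen j k a : shproj k (a *: (gen H j : B)) =
  if j == k then a *: (gen H k : B) else 0.
Proof.
rewrite /shproj coefZ coef_gen eq_sym; case: eqP => _; first by rewrite mulr1.
by rewrite mulr0 scale0r.
Qed.

Lemma shproj_hom k : is_comod_hom (shproj k).
Proof.
have lk := shproj_linear k; split=> // [n b|].
  apply: coef_ext => j; rewrite coef_proj !coef_pr coef_proj.
  by case: eqP => [->|_] //; rewrite (gr0 (@gpr_grading A)).
have kD := linear_morphD lk.
apply: shsum_ext => [b c|b c|j a].
- by rewrite kD coactD.
- by rewrite coactD; exact: (comapD lk).
rewrite /= shcoact_gen -[RHS]/(comap (shproj k) _) (comap_pure lk).
rewrite -[gen H j in RHS]scale1r !shproj_gen scale1r.
case: eqP => _; first by rewrite [LHS]shcoact_gen.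
by rewrite (madd0 (@shcoactD H)) pure0r.
Qed.

Definition shobj : connective_comodules H := exist _ B shcomod_connective.
Definition shend (k : nat) : Defs.hom shobj shobj := exist _ _ (shproj_hom k).

(** [shproj k] preserves the coefficient of [gen k], hence that coefficient of every coordinate.
    Compatibility with coactions can thus be checked one summand at a time. *)
Lemma comap_proj_inj (t u : cotens B) :
  (forall k, comap (shproj k) t = comap (shproj k) u) -> t = u.
Proof.
move=> e; apply: (tcoord_inj (K := K) (laction_scale B)) => i.
apply: coef_ext => k.
have nat v : coef k (tcoord i v) = coef k (tcoord i (comap (shproj k) v)).
  have lk := shproj_linear k.
  rewrite (tcoord_tmap (laction_scale _) (laction_scale _) (linear_morphD lk)
    (linear_scale lk)).
  by rewrite coef_proj eqxx.
by rewrite nat e -nat.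
Qed.

Lemma shsum_product (Z : connective_comodules H)
    (z : nat -> Defs.hom Z shobj) :
  exists b : Defs.hom Z shobj,
    forall k, Defs.comp (shend k) b = Defs.comp (shend k) (z k).
Proof.
have zl k : linear (sval (z k)) by have [] := svalP (z k).
have /choice[b hb] : forall v : sval Z,
    exists b : B, forall k, coef k b = coef k (sval (z k) v).
  move=> v; have [N vN] := deg_le_exists (@cm_grading _ _) v.
  (* Past [N] the coefficient of [gen k] in the image of [v] would have degree at most [N - k < 0],
     hence it vanishes. *)
  exists (of_coefs (fun k => coef k (sval (z k) v)) N.+1) => k.
  apply: coef_of => {}k Nk; apply: (gr_ext (@gpr_grading A)) => n.
  rewrite (gr0 (@gpr_grading A)).
  have [n0|n0] := ltP n 0; first exact: A_neg.
  rewrite -[n](addrK k%:Z) -coef_pr -[shpr _ _]/(@cm_pr _ B _ _).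
  have [_ <- _] := svalP (z k); rewrite vN ?(madd0 (linear_morphD (zl k))) ?coef0 //.
  by apply: (@lt_le_trans _ _ k%:Z); rewrite ?ltz_nat // lerDr.
have pb k v : shproj k (b v) = shproj k (sval (z k) v).
  by apply: coef_ext => j; rewrite !coef_proj hb.
have bhom : is_comod_hom b.
  have bl : linear b.
    by move=> a v w; apply: coef_ext => k; rewrite coefD coefZ !hb zl coefD coefZ.
  split=> // [n v|v].
    apply: coef_ext => k; rewrite coef_pr !hb; have [_ -> _] := svalP (z k).
    by rewrite -coef_pr.
  apply: comap_proj_inj => k; rewrite -[X in _ = comap _ X]/(comap b _).
  rewrite comap_comp; last exact: shproj_linear.
  have [_ _ ek] := shproj_hom k; rewrite -[LHS]ek pb ek.
  have [_ _ zk] := svalP (z k).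
  rewrite zk -[LHS]/(comap (shproj k) (comap (sval (z k)) (coact v))) comap_comp.
    by congr (comap _ _); apply/funext => w; rewrite pb.
  exact: shproj_linear.
by exists (exist _ b bhom) => k; apply: conn_hom_ext => v; exact: pb.
Qed.

Lemma shsum_biproduct : biproduct_projections shend.
Proof.
split=> [|Z g h e|k l kl Z g h|k].
- exact: shsum_product.
- apply: conn_hom_ext; apply: shsum_ext => [b c|b c|k a].
  + exact: comod_homD (svalP g) _ _.
  + exact: comod_homD (svalP h) _ _.
  have := congr1 (fun f => sval f (a *: (gen H k : B))) (e k).
  by rewrite /= shproj_gen eqxx.
- apply: conn_hom_ext => v; apply: coef_ext => j /=.
  by rewrite !coef_proj (introF eqP kl).
exists shobj, (idm _), (exist _ _ (comod_zero_hom B B)) => e.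
have /= := congr1 (fun f => coef k (sval f (gen H k : B))) e.
by rewrite !coef_proj eqxx coef_gen eqxx coef0.
Qed.
End ShiftedSumProjections.

(** * Comparison with modules over a ring *)

Lemma iso_cancel_l (C : category) (X Y Z : C) (i : Defs.hom Y Z)
    (f g : Defs.hom X Y) : is_iso i -> Defs.comp i f = Defs.comp i g -> f = g.
Proof.
by move=> [j [ji _]] e; rewrite -[f]comp_idl -[g]comp_idl -ji -!Defs.compA e.
Qed.

Lemma iso_cancel_r (C : category) (X Y Z : C) (i : Defs.hom X Y)
    (f g : Defs.hom Y Z) : is_iso i -> Defs.comp f i = Defs.comp g i -> f = g.
Proof.
by move=> [j [_ ij]] e; rewrite -[f]comp_idr -[g]comp_idr -ij !Defs.compA e.
Qed.

Lemma nat_iso_faithful (C D : category) (F : functor C D) (G : functor D C)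
    (u : forall X : C, Defs.hom X (G (F X))) :
  (forall X, is_iso (u X)) ->
  (forall (X X' : C) (f : Defs.hom X X'),
    Defs.comp (u X') f = Defs.comp (fmap G (fmap F f)) (u X)) ->
  forall (X Y : C) (f g : Defs.hom X Y), fmap F f = fmap F g -> f = g.
Proof.
by move=> ui un X Y f g e; apply: (iso_cancel_l (ui Y)); rewrite !un e.
Qed.

Lemma nat_iso_faithful_r (C D : category) (F : functor C D) (G : functor D C)
    (v : forall Y : D, Defs.hom (F (G Y)) Y) :
  (forall Y, is_iso (v Y)) ->
  (forall (Y Y' : D) (g : Defs.hom Y Y'),
    Defs.comp g (v Y) = Defs.comp (v Y') (fmap F (fmap G g))) ->
  forall (X Y : D) (f g : Defs.hom X Y), fmap G f = fmap G g -> f = g.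
Proof.
by move=> vi vn X Y f g e; apply: (iso_cancel_r (vi X)); rewrite !vn e.
Qed.

(** All four conditions are about composites, so full faithfulness and essential surjectivity of [F]
    suffice to transfer them. *)
Lemma biproduct_projections_equiv (C D : category) (B : C)
    (e : nat -> Defs.hom B B) : equivalent C D -> biproduct_projections e ->
  exists (B' : D) (e' : nat -> Defs.hom B' B'), biproduct_projections e'.
Proof.
move=> [F [G [u [v [ui vi un vn]]]]] [e1 e2 e3 e4].
have Ff := nat_iso_faithful ui un; have Gf := nat_iso_faithful_r vi vn.
(* The preimage is [fmap G g] conjugated by [u]; naturality of [u] and faithfulness of [G] show that
   [F] maps it to [g]. *)
have full (X Y : C) (g : Defs.hom (F X) (F Y)) :
    exists f : Defs.hom X Y, fmap F f = g.
  have [w [wu uw]] := ui Y; exists (Defs.comp w (Defs.comp (fmap G g) (u X))).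
  apply: Gf; apply: (iso_cancel_r (ui X)).
  by rewrite -un Defs.compA uw comp_idl.
(* [Z] has the form [F X] only up to [v], so morphisms out of it are lifted after precomposing with
   [v Z]. *)
have lift_in (Z : D) (g : Defs.hom Z (F B)) :
    exists f : Defs.hom (G Z) B, fmap F f = Defs.comp g (v Z) by exact: full.
exists (F B), (fun k => fmap F (e k)); split.
- move=> Z z; have /choice[w hw] := fun k => lift_in Z (z k).
  have [b hb] := e1 _ w; have [v' [v'v vv']] := vi Z.
  exists (Defs.comp (fmap F b) v') => k; apply: (iso_cancel_r (vi Z)).
  rewrite -!Defs.compA v'v comp_idr -fmap_comp hb fmap_comp hw.
  by rewrite !Defs.compA.
- move=> Z g h gh; have [v' [v'v vv']] := vi Z.
  have [g' hg] := full _ _ (Defs.comp v' g).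
  have [h' hh] := full _ _ (Defs.comp v' h).
  have v'i : is_iso v' by exists (v Z).
  apply: (iso_cancel_l v'i); rewrite -hg -hh; congr (fmap F _).
  by apply: e2 => k; apply: Ff; rewrite !fmap_comp hg hh -!Defs.compA gh.
- move=> k l kl Z g h; apply: (iso_cancel_r (vi Z)).
  have [[g' hg] [h' hh]] := (lift_in Z g, lift_in Z h).
  by rewrite -!Defs.compA -hg -hh -!fmap_comp (e3 k l kl _ g' h').
move=> k; have [Z [g [h gh]]] := e4 k.
by exists (F Z), (fmap F g), (fmap F h); rewrite -!fmap_comp => /Ff.
Qed.

Section ModuleProjections.
Variable R : pzRingType.

Lemma mod_hom_ext (M N : module_category R) (f g : Defs.hom M N) :
  (forall x, sval f x = sval g x) -> f = g.
Proof.
by case: f g => [f hf] [g hg] e; apply: eq_exist; apply/funext; exact: e.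
Qed.

(** The regular module represents the underlying set; this is the morphism sending 1 to [x]. *)
Definition mod_elt (M : module_category R) (x : (M : lmodType R)) :
  Defs.hom (R^o : module_category R) M.
Proof. by exists (fun r => r *: x) => a r s; rewrite scalerDl scalerA. Defined.

(** The product property yields an element with all components nonzero. The quotient by [S], the
    elements with almost all components zero, kills the image of every [e l] and is therefore zero
    by the coproduct property, so that element lies in [S], a contradiction. *)
Lemma module_no_biproduct (B : module_category R) (e : nat -> Defs.hom B B) :
  ~ biproduct_projections e.
Proof.
move=> [e1 e2 e3 e4]; have el k : linear (sval (e k)) := svalP (e k).
have e0 k : sval (e k) 0 = 0 by exact: madd0 (linear_morphD (el k)).
have orth k l x : k <> l -> sval (e k) (sval (e l) x) = 0.
  move=> /e3/(_ _ (mod_elt x) (mod_elt 0))/(congr1 (fun f => sval f 1)) /=.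
  by rewrite !scale1r !e0.
have /choice[x hx] : forall k, exists x, sval (e k) x <> 0.
  move=> k; apply: contrapT => no; have [Z [g [h]]] := e4 k; apply.
  apply: mod_hom_ext => z /=.
  have z0 y : sval (e k) y = 0 by apply: contrapT => ne; apply: no; exists y.
  by rewrite !z0.
have [b hb] := e1 _ (fun k => mod_elt (x k)).
have {}hb k : sval (e k) (sval b 1) <> 0.
  have /(congr1 (fun f => sval f 1)) /= := hb k.
  by rewrite scale1r => ->; exact: hx.
pose S (y : (B : lmodType R)) :=
  exists N : nat, forall k, (N <= k)%N -> sval (e k) y = 0.
have S0 : S 0 by exists 0%N => k _; exact: e0.
have SD y z : S y -> S z -> S (y + z).
  move=> [N hN] [N' hN']; exists (maxn N N') => k; rewrite geq_max => /andP[h h'].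
  by rewrite (linear_morphD (el k)) hN // hN' // addr0.
have SZ a y : S y -> S (a *: y).
  by move=> [N hN]; exists N => k h; rewrite (linear_scale (el k)) hN // scaler0.
pose q : Defs.hom B (subquot S0 SD SZ : module_category R) :=
  exist _ _ (subproj_linear S0 SD SZ).
have zl : linear (fun _ : (B : lmodType R) => 0 : subquot S0 SD SZ).
  by move=> a y z; rewrite scaler0 addr0.
have qz : q = exist _ _ zl.
  apply: e2 => l; apply: mod_hom_ext => y /=; apply/subproj_eq0.
  by exists l.+1 => k lk; apply: orth => kl; rewrite kl ltnn in lk.
have /subproj_eq0[N hN] : subproj S0 SD SZ (sval b 1) = 0.
  exact: (congr1 (fun f => sval f (sval b 1)) qz).
exact: (hb N) (hN N (leqnn N)).
Qed.
End ModuleProjections.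

Lemma not_module_category (H : hopf_algebroid) : right_coordinates H ->
  (forall n (a : base H), n < 0 -> gpr n a = 0) -> 1 <> 0 :> base H ->
  ~ exists R : pzRingType,
      equivalent (connective_comodules H) (module_category R).
Proof.
move=> K A_neg A1 [R eqR].
have [B [e]] := biproduct_projections_equiv eqR (shsum_biproduct K A_neg A1).
exact: module_no_biproduct.
Qed.

(** * The three Hopf algebroids *)

(** Positive weights bound the length by [N], and [i <= w i] bounds the entries by [N]; [iter k ext]
    lists the words of length at most [k] in the letters 0 to [N]. *)
Lemma bounded_seqs (w : nat -> nat) (N : nat) : exists L : seq (seq nat),
  forall s, (forall i, i \in s -> 0 < w i /\ i <= w i)%N ->
    (\sum_(i <- s) w i <= N)%N -> s \in L.
Proof.
pose ext L := [::] :: [seq i :: s | i <- iota 0 N.+1, s <- L].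
have extP k (s : seq nat) : (size s <= k)%N -> (forall i, i \in s -> i <= N)%N ->
    s \in iter k ext [:: [::]].
  elim: k s => [|k IH] [|i s] //=; rewrite ?inE // ltnS => sk sN; apply/orP; right.
  apply: allpairs_f; first by rewrite mem_iota ltnS sN ?mem_head.
  by apply: IH => // j js; apply: sN; rewrite inE js orbT.
exists (iter N ext [:: [::]]) => s hs sN; apply: extP.
  apply: leq_trans sN; rewrite -sum1_size [leqLHS]big_seq [leqRHS]big_seq.
  by apply: leq_sum => i /hs[].
move=> i si; apply: leq_trans sN; have [_ /leq_trans] := hs i si; apply.
by rewrite (big_rem i) //= leq_addr.
Qed.

Lemma homog_prod (G : gcring) (I : eqType) (x : I -> G) (w : I -> nat)
    (s : seq I) :
  (forall i, i \in s -> homog (@gpr G) (w i)%:Z (x i)) ->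
  homog (@gpr G) (\sum_(i <- s) w i)%N%:Z (\prod_(i <- s) x i).
Proof.
elim: s => [|i s IH] hs; first by rewrite !big_nil; exact: gpr_one.
rewrite !big_cons PoszD; apply: gpr_mul; first by apply: hs; rewrite mem_head.
by apply: IH => j js; apply: hs; rewrite inE js orbT.
Qed.

Lemma mono_pos s i : is_mono s -> i \in s -> (0 < i)%N.
Proof. by move=> /andP[_ s0] si; rewrite lt0n; apply: contraNneq s0 => <-. Qed.

Lemma monomial_homog (G : gcring) (x : nat -> G) (w : nat -> nat) s :
  (forall n, (0 < n)%N -> homog (@gpr G) (w n)%:Z (x n)) -> is_mono s ->
  homog (@gpr G) (\sum_(i <- s) w i)%N%:Z (monomial x s).
Proof. by move=> hx hs; apply: homog_prod => i /(mono_pos hs)/hx. Qed.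

Lemma even_connective_poly (R : pzRingType) (A : gcring) (phi : R -> A)
    (x : nat -> A) (k : nat -> nat) :
  (forall r, homog (@gpr A) 0 (phi r)) ->
  (forall n, (0 < n)%N -> homog (@gpr A) (2 * k n)%N%:Z (x n)) ->
  polynomial_on phi x -> even_connective A.
Proof.
move=> hphi hx [span _] a; have [s [c [_ hs ->]]] := span a.
exists [seq ((\sum_(i <- m) k i)%N, phi (c m) * monomial x m) | m <- s].
  by rewrite big_map.
move=> _ /mapP[m /(allP hs) hm ->] /=; rewrite -[_%:Z]add0r; apply: gpr_mul => //.
by rewrite big_distrr; exact: monomial_homog.
Qed.

(** If [S] were zero, coefficient 1 on [e i] would be a nontrivial relation. *)
Lemma basis_nontrivial (R S : pzRingType) (phi : R -> S) (I : eqType)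
    (P : pred I) (e : I -> S) i :
  is_basis phi P e -> P i -> 1 <> 0 :> R -> 1 <> 0 :> S.
Proof.
move=> [_ free] Pi R1 S1; apply: R1.
have := free [:: i] (fun=> 1) isT; rewrite /= Pi big_seq1.
rewrite -[phi 1 * _]mulr1 S1 mulr0 => /(_ isT erefl i); apply.
exact: mem_head.
Qed.

Lemma homog_int (A : gcring) (z : int) : homog (@gpr A) 0 z%:~R.
Proof.
have gA := @gpr_grading A.
have nat n : homog (@gpr A) 0 n%:R.
  elim: n => [|n IH]; first exact: homog0 gA _.
  by rewrite mulrSr; apply: (homogD gA) => //; exact: gpr_one.
case: z => n; first exact: nat.
by rewrite NegzE mulrNz /homog (maddN (gr_add gA 0)); congr (- _); exact: nat.
Qed.

Lemma coordinates_poly (H : hopf_algebroid) (x : nat -> coop H)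
    (w : nat -> nat) :
  even_connective (base H) ->
  (forall n, (0 < n)%N -> homog (@gpr (coop H)) (w n)%:Z (x n)) ->
  (forall n, n <= w n)%N -> polynomial_on (etaL H) x ->
  inhabited (right_coordinates H).
Proof.
move=> evA hx hw basis.
apply: (right_coordinates_of_left_basis evA basis
  (w := fun s => (\sum_(i <- s) w i)%N)) => [s|N]; first exact: monomial_homog.
have [L hL] := bounded_seqs w N; exists L => s hs; apply: hL => i si.
by split=> //; apply: leq_trans (hw i); exact: mono_pos si.
Qed.

(** The exterior generators are indexed from 0, so strictness in [n < w' n] keeps the weight of
    [y 0] positive, as finiteness requires. *)
Lemma coordinates_exterior (H : hopf_algebroid) (x y : nat -> coop H)
    (w w' : nat -> nat) :
  even_connective (base H) ->
  (forall n, homog (@gpr (coop H)) (w n)%:Z (x n)) ->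
  (forall n, homog (@gpr (coop H)) (w' n)%:Z (y n)) ->
  (forall n, n <= w n)%N -> (forall n, n < w' n)%N ->
  polynomial_exterior_on (etaL H) x y -> inhabited (right_coordinates H).
Proof.
move=> evA hx hy hw hw' basis.
apply: (right_coordinates_of_left_basis evA basis
  (w := fun st => (\sum_(i <- st.1) w i + \sum_(i <- st.2) w' i)%N)).
  move=> [s t] /= /andP[hs _]; rewrite PoszD; apply: gpr_mul.
    exact: monomial_homog.
  exact: homog_prod.
move=> N; have [[L hL] [L' hL']] := (bounded_seqs w N, bounded_seqs w' N).
exists [seq (s, t) | s <- L, t <- L'] => -[s t] /= /andP[hs _] hN.
apply: allpairs_f.
  apply: hL => [i si|]; last by apply: leq_trans hN; rewrite leq_addr.
  by split=> //; apply: leq_trans (hw i); exact: mono_pos si.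
apply: hL' => [i _|]; last by apply: leq_trans hN; rewrite leq_addl.
by have h := hw' i; split; [exact: leq_ltn_trans h|exact: ltnW].
Qed.

Lemma projectives_not_modules (H : hopf_algebroid) :
  inhabited (right_coordinates H) -> even_connective (base H) ->
  1 <> 0 :> base H ->
  has_enough_projectives (connective_comodules H) /\
  ~ exists R : pzRingType,
      equivalent (connective_comodules H) (module_category R).
Proof.
move=> [K] evA A1; split; first exact: enough_projectives.
by apply: not_module_category => //; exact: even_connective_neg.
Qed.

Lemma MU_projectives_not_modules (H : hopf_algebroid) : is_MU H ->
  has_enough_projectives (connective_comodules H) /\
  ~ exists R : pzRingType,
      equivalent (connective_comodules H) (module_category R).
Proof.
move=> [x [a [b [hx [px [_ [_ [_ [hb [pb _]]]]]]]]]].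
have evA : even_connective (base H).
  exact: even_connective_poly (@homog_int _) hx px.
apply: projectives_not_modules => //.
  by apply: (coordinates_poly evA _ _ pb) => [n _|n]; [exact: hb|exact: leq_pmull].
exact: (basis_nontrivial (i := [::]) px).
Qed.

(** Multiplication by [a] preserves degrees, so [a] kills every component of [b] outside degree 0;
    multiplying by [b] kills the component itself. *)
Lemma homog_inverse (A : gcring) (a b : A) :
  homog (@gpr A) 0 a -> a * b = 1 -> b * a = 1 -> homog (@gpr A) 0 b.
Proof.
move=> ha ab ba; have gA := @gpr_grading A.
have shift n : a * gpr n b = gpr n 1.
  rewrite -ab -{2}[n]addr0; symmetry.
  apply: (gr_shift (h := fun y => a * y) gA gA) => [x y|m y hy].
    by rewrite mulrDr.
  by rewrite addrC; exact: gpr_mul.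
apply: (gr_ext gA) => n; rewrite (gr_pr gA).
case: eqP => [->|/eqP/negbTE n0] //; rewrite -[RHS]mul1r -ba -mulrA shift.
by rewrite (homog_proj gA _ (gpr_one A)) n0 mulr0.
Qed.

(** [phi] is given as a ring morphism without any grading; its values have degree 0 because a
    fraction is an integer times the inverse of an integer. *)
Lemma homog_Zloc (p : nat) (A : gcring) (phi : {rmorphism Zloc p -> A}) q :
  homog (@gpr A) 0 (phi q).
Proof.
pose d : int := denq (zloc_val q).
have inv_in : (d%:~R^-1 : rat) \in p_integral p.
  by rewrite -[_^-1]mul1r -[1]/(1%:~R); apply: p_integral_frac; exact: zloc_valP q.
pose e : Zloc p := MkZloc inv_in.
have de : d%:~R * e = 1.
  apply: val_inj; rewrite rmorphM rmorph_int rmorph1 /=.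
  by rewrite mulfV // intr_eq0 denq_neq0.
have -> : q = e * (numq (zloc_val q))%:~R.
  apply: val_inj; rewrite rmorphM rmorph_int /=.
  by rewrite mulrC divq_num_den.
rewrite rmorphM rmorph_int -[0]addr0; apply: gpr_mul; last exact: homog_int.
apply: (homog_inverse (homog_int A d)); rewrite -(rmorph_int phi) -rmorphM.
  by rewrite de rmorph1.
by rewrite mulrC de rmorph1.
Qed.

Lemma leq_pexp_sub1 (p n : nat) : (1 < p -> n <= p ^ n - 1)%N.
Proof. by move=> /(ltn_expl n); case: (p ^ n)%N => // m; rewrite subn1. Qed.

Lemma BP_projectives_not_modules (p : nat) (H : hopf_algebroid) :
  prime p -> is_BP p H ->
  has_enough_projectives (connective_comodules H) /\
  ~ exists R : pzRingType,
      equivalent (connective_comodules H) (module_category R).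
Proof.
move=> /prime_gt1 p1 [phi [v [lam [t [hv [pv [ht [pt _]]]]]]]].
have evA : even_connective (base H).
  exact: even_connective_poly (homog_Zloc phi) hv pv.
apply: projectives_not_modules => //.
  apply: (coordinates_poly evA _ _ pt) => [n _|n]; first exact: ht.
  by apply: leq_trans (leq_pexp_sub1 n p1) _; rewrite leq_pmull.
exact: (basis_nontrivial (i := [::]) pv).
Qed.

Lemma HFp_projectives_not_modules (p : nat) (H : hopf_algebroid) :
  prime p -> is_HFp p H ->
  has_enough_projectives (connective_comodules H) /\
  ~ exists R : pzRingType,
      equivalent (connective_comodules H) (module_category R).
Proof.
move=> /prime_gt1 p1 [phi [/bij_inj inj [hA [xi [_ [_ hG]]]]]].
have evA : even_connective (base H).
  move=> a; exists [:: (0%N, a)]; first by rewrite big_seq1.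
  by move=> x; rewrite inE => /eqP->; exact: hA.
apply: projectives_not_modules => //; last first.
  by rewrite -(rmorph1 phi) -(rmorph0 phi) => /inj/eqP; rewrite oner_eq0.
case: eqP hG => [_ [hxi pxi]|_ [hxi [tau [htau [ptau _]]]]].
  apply: (coordinates_poly evA _ _ pxi) => [n _|n]; first exact: hxi.
  exact: leq_pexp_sub1.
apply: (coordinates_exterior evA hxi htau _ _ ptau) => n.
  by apply: leq_trans (leq_pexp_sub1 n p1) _; rewrite leq_pmull.
have := leq_pexp_sub1 n p1; have : (0 < p ^ n)%N by rewrite expn_gt0 ltnW.
rewrite mul2n -addnn; case: (p ^ n)%N => // m _; rewrite !subn1 addSn /= => h.
by rewrite addnS ltnS (leq_trans h) ?leq_addr.
Qed.

Theorem corollary3p10 (p : nat) (hp : prime p)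
    (MU BP HFp : hopf_algebroid)
    (hMU : is_MU MU) (hBP : is_BP p BP) (hHFp : is_HFp p HFp) :
  (has_enough_projectives (connective_comodules MU) /\
   has_enough_projectives (connective_comodules BP) /\
   has_enough_projectives (connective_comodules HFp)) /\
  (~ (exists R : pzRingType,
        equivalent (connective_comodules MU) (module_category R)) /\
   ~ (exists R : pzRingType,
        equivalent (connective_comodules BP) (module_category R)) /\
   ~ (exists R : pzRingType,
        equivalent (connective_comodules HFp) (module_category R))).
Proof.
have [mu1 mu2] := MU_projectives_not_modules hMU.
have [bp1 bp2] := BP_projectives_not_modules hp hBP.
by have [h1 h2] := HFp_projectives_not_modules hp hHFp.
Qed.
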